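(* Let $N\ge1$, $Z_N=Z(\mathrm U(\mathfrak q_N))$, and let $D=(D_j)_{j\ge1}$ be the sequence of normalized one-row Capelli elements in $Z_N$. Let $\mathcal T$ be the operator on sequences given by $(\mathcal TD)_j=D_{j+1}+jD_j$ ($j\ge1$). Then for every $r\ge1$ the following $(N+1)\times(N+1)$ determinant identity holds in $Z_N$: $$\det\Bigl(\bigl(\mathcal T^kD\bigr)_{r+i}\Bigr)_{0\le i,k\le N}=0.$$ Explicitly, for $m\ge1$ and $k\ge0$, $$\bigl(\mathcal T^kD\bigr)_m=\sum_{l=0}^{k}\frac1{l!}\left(\sum_{t=0}^{l}(-1)^{l-t}\binom lt(m+t)^k\right)D_{m+l}.$$ Thus every entry of the determinant is an explicit scalar linear combination of $D_m,\dots,D_{m+k}$ (with $m=r+i$).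
   Context: Ground field $\mathbb C$. Queer Lie superalgebra: fix $N\ge1$, $I_N=\{-N,\dots,-1,1,\dots,N\}$, $\bar i=0$ if $i>0$ and $\bar i=1$ if $i<0$. Let $E_{ij}$ ($i,j\in I_N$) be the matrix units of $\mathfrak{gl}(N|N)$, of parity $\bar i+\bar j$ mod $2$. $\mathfrak q_N\subset\mathfrak{gl}(N|N)$ is the Lie sub-superalgebra spanned by $F_{ij}=E_{ij}+E_{-i,-j}$ (so $F_{-i,-j}=F_{ij}$). $\mathrm U(\mathfrak q_N)$ is its universal enveloping algebra and $Z_N=Z(\mathrm U(\mathfrak q_N))$ its center (in the superalgebra sense; all central elements are even). Harish-Chandra map: $\mathfrak h_{\bar0}=\bigoplus_{i=1}^N\mathbb C F_{ii}$, $\mathfrak h_{\bar 1}=\bigoplus_{i=1}^N\mathbb C F_{i,-i}$, $\mathfrak n_+$ (resp. $\mathfrak n_-$) is the span of $F_{ij},F_{i,-j}$ with $1\le i<j\le N$ (resp. $1\le j<i\le N$). For $z\in Z_N$, $\mathrm{HC}(z)\in\mathbb C[\lambda_1,\dots,\lambda_N]$ is the polynomial with $z\equiv \mathrm{HC}(z)|_{\lambda_i=F_{ii}}$ modulo $\mathfrak n_-\mathrm U(\mathfrak q_N)+\mathrm U(\mathfrak q_N)\mathfrak n_+$ (no $\rho$-shift). It is known that $\mathrm{HC}$ is an algebra isomorphism of $Z_N$ onto $\Gamma_N$, the algebra of symmetric polynomials $f\in\mathbb C[\lambda_1,\dots,\lambda_N]$ such that $f(t,-t,\lambda_3,\dots,\lambda_N)$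 is independent of $t$ (no condition if $N=1$). Normalized one-row Capelli elements: $(u\downarrow r)=u(u-1)\cdots(u-r+1)$, $(u\downarrow0)=1$. Let $Q^-_{(0)}=1$ and for $r\ge1$ let $Q^-_{(r)}\in\Gamma_N$ be the one-row factorial Schur $Q$-polynomial $Q^-_{(r)}(\lambda)=2\sum_{i=1}^N(\lambda_i\downarrow r)\prod_{j\ne i}\frac{\lambda_i+\lambda_j}{\lambda_i-\lambda_j}$; equivalently $\sum_{r\ge0}Q^-_{(r)}(\lambda)/(u\downarrow r)=\prod_{i=1}^N\frac{u+1+\lambda_i}{u+1-\lambda_i}$ as series in $u^{-1}$. Then $D_0=1$ and $D_r=\frac1{r!}C_{(r)}$ for $r\ge1$, where $C_{(r)}$ is Nazarov's Capelli element of the one-row strict partition $(r)$; $D_r$ is the unique element of $Z_N$ with $\mathrm{HC}(D_r)=Q^-_{(r)}$. Convention: $\mathcal T^0$ is the identity operator, and $0^0=1$ (not needed for $m\ge1$). *)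

(* Defs.v *)
(* The ground field C is instantiated with R[i], R : realType. *)
From HB Require Import structures.
From mathcomp Require Import all_boot all_order all_algebra.
From mathcomp Require Export fraction.
From mathcomp Require Export reals complex mpoly.

Set Implicit Arguments.
Unset Strict Implicit.
Unset Printing Implicit Defensive.

Import GRing.Theory.

Local Open Scope ring_scope.

(* Supercommutator of homogeneous elements x, y of parities p, q
   (true = odd). *)
Definition scomm (A : pzRingType) (p q : bool) (x y : A) : A :=
  x * y - (-1) ^+ (p && q) * (y * x).

(* x (x - 1) ... (x - r + 1) *)
Definition falling (A : pzRingType) (x : A) (r : nat) : A :=
  \prod_(k < r) (x - k%:R).

Section QueerLieSuperalgebra.
Context (C : fieldType) (N : nat).

(* The index set I_N = {-N, ..., -1, 1, ..., N} is encoded as 'I_(N + N):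
   for i : 'I_N, [pos i] stands for i + 1 and [neg i] for -(i + 1). *)
Definition pos (i : 'I_N) : 'I_(N + N) := lshift N i.
Definition neg (i : 'I_N) : 'I_(N + N) := rshift N i.
Definition opp_idx (i : 'I_(N + N)) : 'I_(N + N) :=
  match split i with inl j => neg j | inr j => pos j end.
Definition idx_par (i : 'I_(N + N)) : bool := (N <= i)%N.

Definition gl_homog (p : bool) (X : 'M[C]_(N + N)) : bool :=
  [forall i, forall j, (X i j != 0) ==> (idx_par i (+) idx_par j == p)].

Definition Fmx (i j : 'I_(N + N)) : 'M[C]_(N + N) :=
  delta_mx i j + delta_mx (opp_idx i) (opp_idx j).

Definition queer : {vspace 'M[C]_(N + N)} := (\sum_i \sum_j <[Fmx i j]>)%VS.

(* Fmx i j belongs to queer, so vsproj is here only a cast. *)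
Definition Fq (i j : 'I_(N + N)) : subvs_of queer := vsproj queer (Fmx i j).

Definition nplus : {vspace subvs_of queer} :=
  (\sum_(i < N) \sum_(j < N | (i < j)%N)
     (<[Fq (pos i) (pos j)]> + <[Fq (pos i) (neg j)]>))%VS.

Definition nminus : {vspace subvs_of queer} :=
  (\sum_(i < N) \sum_(j < N | (j < i)%N)
     (<[Fq (pos i) (pos j)]> + <[Fq (pos i) (neg j)]>))%VS.

(* A linear map to an associative algebra that turns the superbracket into
   the supercommutator; the bracket of q_N is the one of gl(N|N), i.e. the
   supercommutator of matrices, and z below is the bracket of x and y. *)
Definition lie_map (A : algType C) (f : {linear subvs_of queer -> A}) : Prop :=
  forall (p q : bool) (x y z : subvs_of queer),
    gl_homog p (vsval x) -> gl_homog q (vsval y) ->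
    vsval z = scomm p q (vsval x) (vsval y) ->
    f z = scomm p q (f x) (f y).

Definition enveloping (U : algType C) (iota : {linear subvs_of queer -> U}) :
    Prop :=
  lie_map iota /\
  forall (A : algType C) (f : {linear subvs_of queer -> A}), lie_map f ->
    exists phi : {lrmorphism U -> A},
      (forall x, phi (iota x) = f x) /\
      (forall psi : {lrmorphism U -> A},
         (forall x, psi (iota x) = f x) -> psi =1 phi).

(* p is the one-row factorial Schur Q-polynomial of (r), r >= 1; the formula
   is an identity of rational functions in lambda_1, ..., lambda_N. *)
Definition is_Qminus (r : nat) (p : {mpoly C[N]}) : Prop :=
  tofrac p =
  2%:R * \sum_(i < N) tofrac (falling ('X_i : {mpoly C[N]}) r)
           * \prod_(j < N | j != i)
               (tofrac ('X_i + 'X_j : {mpoly C[N]})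
                / tofrac ('X_i - 'X_j : {mpoly C[N]})).

Section Enveloping.
Context (U : algType C) (iota : {linear subvs_of queer -> U}).

(* The Z/2-grading of U induced by that of q_N. *)
Inductive env_homog : bool -> U -> Prop :=
| env_homog_gen p x : gl_homog p (vsval x) -> env_homog p (iota x)
| env_homog_one : env_homog false 1
| env_homog_mul p q u v :
    env_homog p u -> env_homog q v -> env_homog (p (+) q) (u * v)
| env_homog_lin p a u v :
    env_homog p u -> env_homog p v -> env_homog p (a *: u + v)
| env_homog_zero p : env_homog p 0.

(* Center in the super sense: both homogeneous components supercommute
   with all homogeneous elements. *)
Definition supercentral (z : U) : Prop :=
  exists z0 z1 : U,
    [/\ z = z0 + z1, env_homog false z0, env_homog true z1 &
        forall q u, env_homog q u ->
          scomm false q z0 u = 0 /\ scomm true q z1 u = 0].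

(* The subspace n_- U + U n_+. *)
Definition triangular_kernel (w : U) : Prop :=
  exists (s : seq (subvs_of queer * U)) (t : seq (U * subvs_of queer)),
    [/\ all (fun yu => yu.1 \in nminus) s,
        all (fun ux => ux.2 \in nplus) t &
        w = \sum_(yu <- s) iota yu.1 * yu.2
          + \sum_(ux <- t) ux.1 * iota ux.2].

(* p at lambda_i = F_ii; these elements of U commute with each other. *)
Definition eval_cartan (p : {mpoly C[N]}) : U :=
  mmap (in_alg U) (fun i => iota (Fq (pos i) (pos i))) p.

(* The graph of the Harish-Chandra map (no rho-shift). *)
Definition is_HC (z : U) (p : {mpoly C[N]}) : Prop :=
  triangular_kernel (z - eval_cartan p).

(* z = D_r, the element of the center with HC(z) = Q^-_(r), for r >= 1. *)
Definition is_capelli (r : nat) (z : U) : Prop :=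
  supercentral z /\ exists2 p, is_Qminus r p & is_HC z p.

End Enveloping.
End QueerLieSuperalgebra.

(* Sequences indexed by j >= 1 are functions on nat whose value at 0 is
   ignored; for j >= 1, seqT D j does not involve D 0. *)
Definition seqT (V : zmodType) (D : nat -> V) : nat -> V :=
  fun j => D j.+1 + D j *+ j.

(* Main.v *)
(* The Harish-Chandra map is multiplicative on the center, and T multiplies the
   falling power (x | m) by x, so T^k Q^-_m = sum_s c_s x_s^k (x_s | m) with
   c_s = 2 prod_{j <> s} (x_s + x_j) / (x_s - x_j).  Hence the determinant of
   the images is that of a product of an (N+1) x N by an N x (N+1) matrix, which
   is zero, and it remains to see that the Harish-Chandra map is injective.

   For this let U(q_N) act on the graded tensor powers of V' = C + C^{N|N}, the
   first summand being the trivial representation.  These are jointly faithful: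
   on the d-th power, functionals on End(V') that kill 1 and the parity operator
   recover the degree d part of an element of filtration degree at most d.  As
   F_ij^* = F_ji, the image of U(q_N) is stable under adjoints, so central
   elements act by normal operators, and a central element in n_- U + U n_+ acts
   nilpotently by a highest weight argument; so it acts by zero. *)
Require Import Defs.
From HB Require Import structures.
From mathcomp Require Import all_boot all_order all_algebra.
From mathcomp Require Import mxtens boolp.

Set Implicit Arguments.
Unset Strict Implicit.
Unset Printing Implicit Defensive.

Import Order.TTheory GRing.Theory Num.Theory.

Local Open Scope ring_scope.

(** * The operator T and falling powers *)

Section IteratedShift.
Variables (C : numFieldType) (V : lmodType C).

Let coef (k l m : nat) : C :=
  (l`!)%:R^-1 *
  \sum_(t < l.+1) (-1) ^+ (l - t) * ('C(l, t))%:R * ((m + t) ^ k)%N%:R.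

Let coefS0 k m : coef k.+1 0 m = m%:R * coef k 0 m.
Proof.
rewrite /coef !big_ord1 /= !addn0 fact0 invr1 !mul1r.
by rewrite expnS natrM.
Qed.

(* coef k l m is the divided difference of x^k at m, ..., m + l, and this is
   the Leibniz rule for x * x^k. *)
Let coefSS k l m : coef k.+1 l.+1 m = coef k l m.+1 + m%:R * coef k l.+1 m.
Proof.
rewrite /coef.
under eq_bigr => t _ do rewrite expnS mulnDl natrD mulrDr.
rewrite big_split /= mulrDr addrC; congr (_ + _); last first.
  rewrite mulrCA; congr (_ * _); rewrite big_distrr /=.
  by apply: eq_bigr => t _; rewrite natrM mulrCA.
(* The factor t kills the term t = 0; in the others t * C(l+1, t) = (l+1) * C(l, t-1) cancels a
   factor of (l+1)!. *)
rewrite big_ord_recl /= mul0n mulr0 add0r factS natrM invfM.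
rewrite [_^-1 * _^-1]mulrC -mulrA; congr (_ * _).
apply: (canLR (mulKf _)); first by rewrite pnatr_eq0.
rewrite big_distrr /=; apply: eq_bigr => t _.
rewrite /bump /= add1n subSS addSnnS natrM mulrA mulrA mulrCA -!mulrA.
congr (_ * _); rewrite !mulrA; congr (_ * _).
by rewrite -!natrM mulnC -mul_bin_diag.
Qed.

(** Divided differences of order above the degree vanish: for k = 0 this expands (-1 + 1)^(l+1), and
    [coefSS] gives the induction. *)
Let coef_gt k l m : (k < l)%N -> coef k l m = 0.
Proof.
elim: k l m => [|k IHk] [|l] m //.
  move=> _; rewrite /coef; apply/eqP; rewrite mulf_eq0; apply/orP; right.
  under eq_bigr => t _ do rewrite expn0 mulr1.
  have := exprDn (-1 : C) 1 l.+1; rewrite addNr expr0n /= => /esym E.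
  apply/eqP; rewrite -[RHS]E; apply: eq_bigr => t _.
  by rewrite expr1n mulr1 mulr_natr.
by move=> lt_kl; rewrite coefSS !IHk ?mulr0 ?addr0 // ltnW.
Qed.

(** Induction on k: the two terms of [coefSS] match the two terms of [seqT], and [coef_gt] removes
    the extra index l = k + 1. *)
Lemma iter_seqT_sum (D : nat -> V) (m k : nat) :
  iter k (@seqT V) D m =
  \sum_(l < k.+1)
     ((l`!)%:R^-1 *
      \sum_(t < l.+1)
         (-1) ^+ (l - t) * ('C(l, t))%:R * ((m + t) ^ k)%N%:R : C)
     *: D (m + l)%N.
Proof.
suff: iter k (@seqT V) D m = \sum_(l < k.+1) coef k l m *: D (m + l)%N by [].
elim: k m => [|k IHk] m.
  rewrite big_ord1 /coef /= big_ord1 fact0 invr1 !mul1r expn0.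
  by rewrite scale1r addn0.
rewrite iterS /seqT !IHk [RHS]big_ord_recl /= coefS0.
under [in RHS]eq_bigr => l _ do rewrite coefSS scalerDl.
rewrite big_split /= addrCA; congr (_ + _).
  by apply: eq_bigr => l _; rewrite /bump /= add1n addSnnS.
rewrite big_ord_recl /= mulrnDl.
rewrite -[in LHS]scaler_nat scalerA; congr (_ + _).
rewrite big_ord_recr /= coef_gt ?mulr0 ?scale0r ?addr0 //.
rewrite -sumrMnl; apply: eq_bigr => l _.
by rewrite -scaler_nat scalerA.
Qed.

End IteratedShift.

Lemma rmorph_iter_seqT (A B : pzRingType) (f : {rmorphism A -> B})
    (D : nat -> A) (k m : nat) :
  f (iter k (@seqT A) D m) = iter k (@seqT B) (f \o D) m.
Proof. by elim: k m => //= k IHk m; rewrite /seqT rmorphD rmorphMn !IHk. Qed.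

Lemma iter_seqT_ext (V : zmodType) (D D' : nat -> V) (k m : nat) :
  (forall j, (0 < j)%N -> D j = D' j) -> (0 < m)%N ->
  iter k (@seqT V) D m = iter k (@seqT V) D' m.
Proof.
by move=> eqD; elim: k m => [|k IHk] m m_gt0 /=; rewrite ?eqD // /seqT !IHk.
Qed.

Lemma fallingSr (A : pzRingType) (x : A) (r : nat) :
  falling x r.+1 = falling x r * (x - r%:R).
Proof. by rewrite /falling big_ord_recr. Qed.

Lemma rmorph_falling (A B : pzRingType) (f : {rmorphism A -> B}) (x : A) r :
  f (falling x r) = falling (f x) r.
Proof.
by rewrite /falling rmorph_prod; apply: eq_bigr => k _;
  rewrite rmorphB rmorph_nat.
Qed.

(* T turns the falling powers of x into x times themselves. *)
Lemma iter_seqT_falling (A : comPzRingType) (n : nat) (c x : 'I_n -> A) k m :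
  iter k (@seqT A) (fun j => \sum_s c s * falling (x s) j) m =
  \sum_s c s * x s ^+ k * falling (x s) m.
Proof.
elim: k m => [|k IHk] m; first by apply: eq_bigr => s _; rewrite mulr1.
rewrite iterS /seqT !IHk -sumrMnl -big_split; apply: eq_bigr => s _ /=.
rewrite fallingSr exprSr -mulrnAr -mulrDr -!mulrA; congr (_ * (_ * _)).
by rewrite mulrBr mulr_natr subrK mulrC.
Qed.

Lemma det_mulmx_low_rank (F : fieldType) (n : nat) (A : 'M[F]_(n.+1, n))
    (B : 'M[F]_(n, n.+1)) : \det (A *m B) = 0.
Proof.
apply/eqP/negP => /negP; rewrite -unitfE -unitmxE -row_free_unit.
rewrite /row_free => /eqP rkAB; have := mxrankM_maxr A B.
by rewrite rkAB leqNgt ltnS rank_leq_row.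
Qed.

Lemma det_iter_seqT_Qminus (C : fieldType) (N : nat)
    (p : nat -> {mpoly C[N]}) (r : nat) :
  (forall j, (0 < j)%N -> is_Qminus j (p j)) -> (0 < r)%N ->
  \det (\matrix_(i < N.+1, k < N.+1) iter k (@seqT _) p (r + i)%N) = 0.
Proof.
(* The denominators of c_s live in the fraction field, into which the polynomials embed. *)
move=> Qp r_gt0; apply/eqP; rewrite -tofrac_eq0 -det_map_mx.
pose x (s : 'I_N) : {fraction {mpoly C[N]}} := tofrac 'X_s.
pose c (s : 'I_N) : {fraction {mpoly C[N]}} :=
  2%:R * \prod_(j < N | j != s) (tofrac ('X_s + 'X_j) / tofrac ('X_s - 'X_j)).
suff -> : map_mx (@tofrac _) (\matrix_(i < N.+1, k < N.+1) iter k (@seqT _) p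
  (r + i)%N) =
   (\matrix_(i < N.+1, s < N) falling (x s) (r + i))
     *m (\matrix_(s < N, k < N.+1) (c s * x s ^+ k)).
  by rewrite det_mulmx_low_rank.
apply/matrixP => i k; rewrite !mxE rmorph_iter_seqT.
rewrite (@iter_seqT_ext _ _ (fun j =>
  \sum_s c s * falling (x s) j)) ?addn_gt0 ?r_gt0 //.
  by rewrite iter_seqT_falling; apply: eq_bigr => s _; rewrite !mxE mulrC.
move=> j j_gt0 /=; rewrite (Qp j j_gt0) big_distrr; apply: eq_bigr => s _ /=.
by rewrite rmorph_falling mulrA [RHS]mulrAC.
Qed.

(** * The queer Lie superalgebra *)

Lemma scommE (A : pzRingType) (p q : bool) (x y : A) :
  scomm p q x y = x * y - (if p && q then - (y * x) else y * x).
Proof. by rewrite /scomm; case: (p && q); rewrite ?mulN1r ?mul1r. Qed.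

Section QueerMatrices.
Variables (C : fieldType) (N : nat).
Local Notation k := (N + N)%N.
Implicit Types (x y : 'M[C]_k) (a b : 'I_k) (p q : bool).

Lemma opp_pos (i : 'I_N) : opp_idx (pos i) = neg i.
Proof. by rewrite /opp_idx /pos; case: split_ordP => j /eqP;
  rewrite ?eq_lshift ?eq_lrshift // => /eqP ->. Qed.

Lemma opp_neg (i : 'I_N) : opp_idx (neg i) = pos i.
Proof. by rewrite /opp_idx /neg; case: split_ordP => j /eqP;
  rewrite ?eq_rshift ?eq_rlshift // => /eqP ->. Qed.

Lemma idx_cases a : (exists i, a = pos i) \/ (exists i, a = neg i).
Proof. by case: (split_ordP a) => i ->; [left|right]; exists i. Qed.

Lemma opp_idxK : involutive (@opp_idx N).
Proof.
by move=> a; case: (idx_cases a) => -[i ->]; rewrite ?(opp_pos, opp_neg).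
Qed.

Lemma opp_idx_inj : injective (@opp_idx N).
Proof. exact: inv_inj opp_idxK. Qed.

Lemma par_pos (i : 'I_N) : idx_par (pos i) = false.
Proof. by rewrite /idx_par /= leqNgt ltn_ord. Qed.

Lemma par_neg (i : 'I_N) : idx_par (neg i) = true.
Proof. by rewrite /idx_par /= leq_addr. Qed.

Lemma par_opp a : idx_par (opp_idx a) = ~~ idx_par a.
Proof.
by case: (idx_cases a) => -[i ->];
  rewrite ?(opp_pos, opp_neg) ?(par_pos, par_neg).
Qed.

Lemma FmxE a b i j : Fmx C a b i j =
  ((i == a) && (j == b))%:R + ((i == opp_idx a) && (j == opp_idx b))%:R.
Proof. by rewrite !mxE. Qed.

Lemma Fmx_queer a b : Fmx C a b \in queer C N.
Proof.
rewrite /queer memvE; apply: (sumv_sup a) => //.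
exact: (sumv_sup b).
Qed.

Lemma queer_sym x : x \in queer C N ->
  forall a b, x (opp_idx a) (opp_idx b) = x a b.
Proof.
rewrite /queer => /memv_sumP[f Hf ->] a b; rewrite !summxE;
  apply: eq_bigr => i _.
have /memv_sumP[g Hg ->] := Hf i isT; rewrite !summxE; apply: eq_bigr => j _.
have /vlineP[c ->] := Hg j isT; rewrite !mxE.
by rewrite !(inj_eq opp_idx_inj) !(can2_eq opp_idxK opp_idxK) addrC.
Qed.

(** As F_{-a,-b} = F_{a,b}, positive first indices suffice, and the coefficients are read off in the
    rows of positive index. *)
Lemma sym_expand x : (forall a b, x (opp_idx a) (opp_idx b) = x a b) ->
  x = \sum_(i < N) \sum_b x (pos i) b *: Fmx C (pos i) b.
Proof.
move=> symx.
have pick (y : 'M[C]_k) (l : 'I_N) c :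
    \sum_(i < N) \sum_b y (pos i) b * ((l == i) && (c == b))%:R = y (pos l) c.
  rewrite (bigD1 l) //= (bigD1 c) //= !eqxx mulr1 !big1 ?addr0 // =>
    i /negbTE ne.
    by rewrite big1 // => b _; rewrite eq_sym ne mulr0.
  by rewrite eq_sym ne andbF mulr0.
apply/matrixP => a b; rewrite summxE.
case: (idx_cases a) => -[l ->].
  rewrite -[LHS]pick; apply: eq_bigr => i _; rewrite summxE;
    apply: eq_bigr => j _.
  by rewrite mxE FmxE opp_pos eq_lrshift /= addr0 eq_lshift.
rewrite -symx opp_neg -[LHS]pick; apply: eq_bigr => i _; rewrite summxE;
  apply: eq_bigr => j _.
rewrite mxE FmxE opp_pos eq_rlshift /= add0r eq_rshift.
by rewrite (can2_eq opp_idxK opp_idxK).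
Qed.

(** Membership in a span becomes an entrywise symmetry, which makes closure under products, parity
    parts and adjoints immediate. *)
Lemma queerP x : reflect (forall a b, x (opp_idx a) (opp_idx b) = x a b)
  (x \in queer C N).
Proof.
apply: (iffP idP) => [|symx]; first exact: queer_sym.
rewrite (sym_expand symx); do 2!apply: memv_suml => ? _.
exact/memvZ/Fmx_queer.
Qed.

Lemma queer_mul x y : x \in queer C N -> y \in queer C N -> x * y \in queer C N.
Proof.
move=> /queerP sx /queerP sy; apply/queerP => a b; rewrite !mxE.
rewrite (reindex_inj opp_idx_inj); apply: eq_bigr => c _; rewrite sx.
by rewrite sy.
Qed.

Lemma queer_scomm p q x y : x \in queer C N -> y \in queer C N ->
  scomm p q x y \in queer C N.
Proof.
move=> qx qy; rewrite scommE rpredB ?queer_mul //.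
by case: ifP; rewrite ?rpredN queer_mul.
Qed.

Definition par_part p x : 'M[C]_k :=
  \matrix_(i, j) (x i j *+ (idx_par i (+) idx_par j == p)).

Lemma par_part_is_linear p : linear (par_part p).
Proof.
by move=> c x y; apply/matrixP => i j; rewrite !mxE mulrnDl mulrnAr.
Qed.
HB.instance Definition _ p :=
  GRing.isLinear.Build C 'M[C]_k 'M[C]_k _ (par_part p) (par_part_is_linear p).

Lemma par_part_sum x : x = par_part false x + par_part true x.
Proof.
apply/matrixP => i j; rewrite !mxE.
by case: (_ (+) _); rewrite ?addr0 ?add0r.
Qed.

Lemma gl_homogP p x :
  reflect (forall i j, x i j != 0 ->
    idx_par i (+) idx_par j = p) (gl_homog p x).
Proof.
apply: (iffP forallP) => [H i j nz | H i].
  by have /forallP/(_ j)/implyP/(_ nz)/eqP := H i.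
by apply/forallP => j; apply/implyP => nz; rewrite (H i j nz).
Qed.

Lemma par_part_homog p x : gl_homog p (par_part p x).
Proof.
apply/gl_homogP => i j; rewrite mxE.
by case: (_ =P p) => //=; rewrite mulr0n eqxx.
Qed.

Lemma par_part_id p q x : gl_homog p x -> par_part q x = x *+ (p == q).
Proof.
move=> /gl_homogP hx; apply/matrixP => i j; rewrite mxE mulmxnE.
by have [->|/hx ->] := eqVneq (x i j) 0; rewrite ?mul0rn.
Qed.

Lemma par_part_queer p x : x \in queer C N -> par_part p x \in queer C N.
Proof.
move=> /queerP sx; apply/queerP => a b; rewrite !mxE sx !par_opp.
by rewrite addNb addbN negbK.
Qed.

Lemma homog_mul p q x y :
  gl_homog p x -> gl_homog q y -> gl_homog (p (+) q) (x * y).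
Proof.
move=> /gl_homogP hx /gl_homogP hy; apply/gl_homogP => i j; rewrite mxE => nz.
have [l nzl] : exists l, x i l * y l j != 0.
  apply/existsP; apply: contraNT nz; rewrite negb_exists => /forallP H.
  by apply/eqP/big1 => l _; have /negPn/eqP := H l.
move: nzl; rewrite mulf_eq0 negb_or => /andP[/hx <- /hy <-].
by rewrite addbA -[idx_par i (+) _ (+) _]addbA addbb addbF.
Qed.

Lemma homog_scomm p q x y :
  gl_homog p x -> gl_homog q y -> gl_homog (p (+) q) (scomm p q x y).
Proof.
move=> hx hy; have /gl_homogP hxy := homog_mul hx hy.
have /gl_homogP := homog_mul hy hx; rewrite addbC => hyx.
apply/gl_homogP => i j; rewrite scommE mxE.
have [->|/hxy //] := eqVneq ((x * y) i j) 0; rewrite add0r => nz.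
by apply: hyx; apply: contraNneq nz => E; case: ifP => _;
  rewrite ?opprK ?E // mxE E oppr0.
Qed.

Lemma homog_Fmx a b : gl_homog (idx_par a (+) idx_par b) (Fmx C a b).
Proof.
apply/gl_homogP => i j; rewrite FmxE.
have [/andP[/eqP-> /eqP->] //|_] := boolP ((i == a) && (j == b)).
have [/andP[/eqP-> /eqP->]|_] := boolP ((i == opp_idx a) && _).
  by rewrite !par_opp addNb addbN negbK.
by rewrite addr0 eqxx.
Qed.

End QueerMatrices.

(** * Graded tensor powers *)

(** In the supercommutator on a graded tensor product, b and b' are the mixed terms. *)
Lemma cancel_cross (V : zmodType) (a a' b b' c c' : V) :
  a + b + (b' + c) - (a' + b' + (b + c')) = a - a' + (c - c').
Proof.
rewrite (addrACA a) opprD [LHS]addrACA (opprD a') (opprD b).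
by rewrite (addrACA a) (addrACA b) !subrr addr0 add0r.
Qed.

Section TensorLinear.
Variables (R : comPzRingType) (m n : nat).
Implicit Types (A : 'M[R]_m) (B : 'M[R]_n).

Lemma tensmxDl A A' B : (A + A') *t B = A *t B + A' *t B.
Proof. by apply/matrixP => i j; rewrite !mxE mulrDl. Qed.

Lemma tensmxDr A B B' : A *t (B + B') = A *t B + A *t B'.
Proof. by apply/matrixP => i j; rewrite !mxE mulrDr. Qed.

Lemma tensmxNl A B : (- A) *t B = - (A *t B).
Proof. by apply/matrixP => i j; rewrite !mxE mulNr. Qed.

Lemma tensmxNr A B : A *t (- B) = - (A *t B).
Proof. by apply/matrixP => i j; rewrite !mxE mulrN. Qed.

Lemma tensmxZl c A B : (c *: A) *t B = c *: (A *t B).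
Proof. by apply/matrixP => i j; rewrite !mxE mulrA. Qed.

Lemma tensmxZr c A B : A *t (c *: B) = c *: (A *t B).
Proof. by apply/matrixP => i j; rewrite !mxE mulrCA. Qed.

Lemma tensmxM A A' B B' : (A *t B) * (A' *t B') = (A * A') *t (B * B').
Proof. exact: tensmx_mul. Qed.

(** The (i, j) entry of X when matrices of size m * n are read as m by m matrices of n by n
    blocks. *)
Definition tens_block (i j : 'I_m) (X : 'M[R]_(m * n)) : 'M[R]_n :=
  \matrix_(a, b) X (mxtens_index (i, a)) (mxtens_index (j, b)).

Lemma tens_block_is_linear i j : linear (tens_block i j).
Proof. by move=> c X Y; apply/matrixP => a b; rewrite !mxE. Qed.
HB.instance Definition _ i j :=
  GRing.isLinear.Build R _ _ _ (tens_block i j) (tens_block_is_linear i j).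

Lemma tens_block_tensmx i j A B : tens_block i j (A *t B) = A i j *: B.
Proof. by apply/matrixP => a b; rewrite mxE tensmxE mxE. Qed.

Lemma tens_block_mul i j (X Y : 'M[R]_(m * n)) :
  tens_block i j (X * Y) = \sum_l tens_block i l X * tens_block l j Y.
Proof.
apply/matrixP => a b; rewrite mxE summxE mxE.
under [RHS]eq_bigr => l _ do rewrite mxE.
rewrite pair_bigA /= (reindex (@mxtens_index m n)) /=; last first.
  exists (@mxtens_unindex m n) => ? _; first exact: mxtens_indexK.
  exact: mxtens_unindexK.
by apply: eq_bigr => -[l c] _; rewrite !mxE.
Qed.

(* The graded tensor product of two representations, with the Koszul sign
   carried by the parity operator J. *)
Lemma scomm_tens (p q : bool) (J a a' : 'M[R]_m) (b b' : 'M[R]_n) :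
  J * J = 1 -> J * a = (-1) ^+ p *: (a * J) -> J * a' = (-1) ^+ q *: (a' * J) ->
  scomm p q (a *t 1%:M + J ^+ p *t b) (a' *t 1%:M + J ^+ q *t b') =
  scomm p q a a' *t 1%:M + J ^+ (p (+) q) *t scomm p q b b'.
Proof.
move=> JJ Ja Ja'; rewrite !scommE.
have JpE : J ^+ p * a' = (-1) ^+ (p && q) *: (a' * J ^+ p).
  by case: p {Ja} => /=; rewrite ?expr1 // !expr0 mul1r mulr1 scale1r.
have JqE : a * J ^+ q = (-1) ^+ (p && q) *: (J ^+ q * a).
  case: q {Ja' JpE} => /=; last by rewrite andbF !expr0 mul1r mulr1 scale1r.
  by rewrite andbT !expr1 Ja scalerA -expr2 sqrr_sign scale1r.
have JJE : J ^+ p * J ^+ q = J ^+ (p (+) q).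
  by case: p q {Ja Ja' JpE JqE} => [] [] /=;
    rewrite ?expr0 ?expr1 ?mulr1 ?mul1r.
have JJE' : J ^+ q * J ^+ p = J ^+ (p (+) q) by rewrite -JJE -!exprD addnC.
rewrite !(mulrDl, mulrDr) !tensmxM !(mulr1, mul1r) JpE JqE JJE JJE'.
rewrite tensmxDl tensmxDr !tensmxZl !tensmxNl !tensmxNr.
case: (p && q); rewrite ?(expr1, expr0, scaleN1r, scale1r, tensmxNl, tensmxNr,
  opprK).
  have := cancel_cross (a * a' *t 1%:M) (- (a' * a *t 1%:M))
    (- (J ^+ q * a *t b')) (- (a' * J ^+ p *t b))
    (J ^+ (p (+) q) *t (b * b')) (- (J ^+ (p (+) q) *t (b' * b))).
  by rewrite !opprD !opprK.
exact: cancel_cross.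
Qed.
End TensorLinear.

(** * The action of q_N on the tensor powers of C + C^{N|N} *)

Section TensorRepresentation.
Variables (C : fieldType) (N : nat).
Local Notation k := (N + N)%N.
Implicit Types (x y : 'M[C]_k) (p q : bool).

(* The representation space of dimension 1 + 2N is the sum of a trivial even
   line and of the natural representation.  The trivial line is what makes
   the tensor powers jointly faithful: it lets functionals kill the identity
   and the parity operator while being free on q_N. *)
Definition ext x : 'M[C]_(1 + k) := block_mx 0 0 0 x.

Definition ext_par (a : 'I_(1 + k)) : bool :=
  match split a with inl _ => false | inr i => idx_par i end.

Definition parmx : 'M[C]_(1 + k) := diag_mx (\row_a (-1) ^+ ext_par a).

Lemma ext_par0 (i : 'I_1) : ext_par (lshift k i) = false.
Proof. by rewrite /ext_par (unsplitK (inl _ i)). Qed.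

Lemma ext_parS (i : 'I_k) : ext_par (rshift 1 i) = idx_par i.
Proof. by rewrite /ext_par (unsplitK (inr _ i)). Qed.

Lemma ext_is_linear : linear ext.
Proof.
move=> c x y; rewrite /ext scale_block_mx add_block_mx !scaler0 !addr0.
by [].
Qed.
HB.instance Definition _ := GRing.isLinear.Build C _ _ _ ext ext_is_linear.

Lemma ext_mul x y : ext (x * y) = ext x * ext y.
Proof.
rewrite /ext [RHS]mulmx_block !mulmx0 !mul0mx !addr0 add0r.
by [].
Qed.

Lemma ext_scomm p q x y : ext (scomm p q x y) = scomm p q (ext x) (ext y).
Proof.
rewrite !scommE linearB /= ext_mul; congr (_ - _).
by case: ifP => _; rewrite ?linearN /= ?ext_mul.
Qed.

Lemma ext_pos x (i : 'I_k) j : ext x (rshift 1 i) (rshift 1 j) = x i j.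
Proof. by rewrite /ext block_mxEdr. Qed.

Lemma parmxE a b : parmx a b = (-1) ^+ ext_par a *+ (a == b).
Proof. by rewrite /parmx !mxE. Qed.

Lemma parmx_sq : parmx * parmx = 1.
Proof.
rewrite /parmx -[LHS]/(_ *m _) mulmx_diag; apply/matrixP => a b; rewrite !mxE.
by rewrite -expr2 sqrr_sign.
Qed.

Lemma parmx_exp_row (p : bool) a b : ext_par a = false ->
  (parmx ^+ p) a b = (a == b)%:R.
Proof. by case: p => pa; rewrite ?expr1 ?expr0 ?parmxE ?pa // mxE. Qed.

Lemma parmx_expD (p q : bool) : parmx ^+ p * parmx ^+ q = parmx ^+ (p (+) q).
Proof.
by case: p q => [] [] /=; rewrite ?expr0 ?expr1 ?mulr1 ?mul1r ?parmx_sq.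
Qed.

Lemma parmx_ext p x : gl_homog p x ->
  parmx * ext x = (-1) ^+ p *: (ext x * parmx).
Proof.
move=> /gl_homogP hx; rewrite /parmx -[_ * _]/(_ *m _) -[ext x * _]/(_ *m _).
rewrite mul_diag_mx mul_mx_diag /ext; apply/matrixP => a b.
rewrite [LHS]mxE [RHS]mxE [X in _ = _ * X]mxE !(mxE _ _ 0).
case: (split_ordP a) => i ->; case: (split_ordP b) => j ->.
- by rewrite block_mxEul !mxE mulr0 mul0r mulr0.
- by rewrite block_mxEur !mxE mulr0 mul0r mulr0.
- by rewrite block_mxEdl !mxE mulr0 mul0r mulr0.
rewrite block_mxEdr !ext_parS.
have [->|/hx <-] := eqVneq (x i j) 0; first by rewrite mulr0 mul0r mulr0.
rewrite signr_addb mulrCA -mulrA [_ * ((-1) ^+ _ * _)]mulrCA.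
by rewrite [X in _ = _ * (_ *
  X)]mulrC mulrA -[in RHS]mulrA -expr2 sqrr_sign mulr1 mulrC.
Qed.

(** One less than the dimension (1 + 2N)^d. As a successor the size gives a nonzero matrix ring, and
    this recursion makes it convertible to [(1 + k) * (tensdim e).+1]. *)
Fixpoint tensdim d := if d is e.+1 then (tensdim e +
  k * (tensdim e).+1)%N else 0%N.

(** The Koszul sign J^p depends on the parity, so each homogeneous component of x gets its own
    action; [tensrep] adds the two. The power d = 0 is the trivial representation. *)
Fixpoint tensrep_par d p x : 'M[C]_((tensdim d).+1) :=
  match d return 'M[C]_((tensdim d).+1) with
  | 0 => 0
  | e.+1 => (ext (par_part p x) *t 1%:M + parmx ^+ p *t tensrep_par e p x
             : 'M[C]_((1 + k) * (tensdim e).+1))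
  end.

Lemma tensrep_par_is_linear d p : linear (tensrep_par d p).
Proof.
move=> c x y; elim: d => [|d IHd] /=; first by rewrite scaler0 addr0.
rewrite IHd !linearP /= tensmxDl tensmxDr tensmxZl tensmxZr.
by rewrite scalerDr addrACA.
Qed.
HB.instance Definition _ d p :=
  GRing.isLinear.Build C _ _ _ (tensrep_par d p) (tensrep_par_is_linear d p).

Lemma tensrep_par_homog d p q x : gl_homog p x -> p != q ->
  tensrep_par d q x = 0.
Proof.
move=> hx npq; elim: d => [|d IHd] //=.
rewrite IHd (par_part_id q hx) (negbTE npq) mulr0n linear0.
by apply/matrixP => i j; rewrite !mxE !mul0r mulr0 addr0.
Qed.

Lemma tensrep_par_scomm d p q x y : gl_homog p x -> gl_homog q y ->
  tensrep_par d (p (+) q) (scomm p q x y) =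
  scomm p q (tensrep_par d p x) (tensrep_par d q y).
Proof.
move=> hx hy; elim: d => [|d IHd].
  by rewrite /= scommE mul0r oppr0 if_same subr0.
rewrite /= IHd (par_part_id _ hx) (par_part_id _ hy).
rewrite (par_part_id _ (homog_scomm hx hy)) !eqxx !mulr1n ext_scomm.
exact/esym/(@scomm_tens C (1 + k) (tensdim d).+1 p q parmx (ext x) (ext y) _ _
  parmx_sq (parmx_ext hx) (parmx_ext hy)).
Qed.

Definition tensrep d x := tensrep_par d false x + tensrep_par d true x.

Lemma tensrep_is_linear d : linear (tensrep d).
Proof. by move=> c x y; rewrite /tensrep !linearP /= scalerDr addrACA. Qed.
HB.instance Definition _ d :=
  GRing.isLinear.Build C _ _ _ (tensrep d) (tensrep_is_linear d).

Lemma tensrep_homog d p x : gl_homog p x -> tensrep d x = tensrep_par d p x.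
Proof.
case: p => hx; rewrite /tensrep.
  by rewrite (tensrep_par_homog d hx) // add0r.
by rewrite [X in _ + X](tensrep_par_homog d hx) // addr0.
Qed.

Lemma tensrep_scomm d p q x y : gl_homog p x -> gl_homog q y ->
  tensrep d (scomm p q x y) = scomm p q (tensrep d x) (tensrep d y).
Proof.
move=> hx hy; rewrite (tensrep_homog d hx) (tensrep_homog d hy).
by rewrite (tensrep_homog d (homog_scomm hx hy)) tensrep_par_scomm.
Qed.

Lemma is_diag_par_part p x : is_diag_mx x -> is_diag_mx (par_part p x).
Proof.
move=> /is_diag_mxP dx; apply/is_diag_mxP => i j ne; rewrite mxE dx //.
by rewrite mul0rn.
Qed.

Lemma is_diag_ext x : is_diag_mx x -> is_diag_mx (ext x).
Proof. by move=> dx; rewrite /ext is_diag_block_mx // !eqxx mx0_is_diag. Qed.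

Lemma is_diag_tens m n (A : 'M[C]_m) (B : 'M[C]_n) :
  is_diag_mx A -> is_diag_mx B -> is_diag_mx (A *t B).
Proof.
move=> /is_diag_mxP dA /is_diag_mxP dB; apply/is_diag_mxP => a b.
rewrite -(mxtens_unindexK a) -(mxtens_unindexK b) tensmxE => ne.
have [E|nE] := eqVneq (mxtens_unindex a).1 (mxtens_unindex b).1; last first.
  by rewrite dA ?mul0r.
rewrite dB ?mulr0 //; apply: contraNneq ne => E'; apply/eqP;
  congr (val (mxtens_index _)).
rewrite [LHS]surjective_pairing [RHS]surjective_pairing E; congr (_, _).
exact: val_inj.
Qed.

(** All tensor factors, J included, are diagonal; so coordinate vectors are weight vectors of the
    even Cartan subalgebra. *)
Lemma tensrep_diag d x : is_diag_mx x -> is_diag_mx (tensrep d x).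
Proof.
move=> dx; suff H p : is_diag_mx (tensrep_par d p x).
  apply/is_diag_mxP => i j ne; rewrite mxE.
  by rewrite (is_diag_mxP (H _)) // (is_diag_mxP (H _)) // addr0.
elim: d => [|d IHd] /=; first exact: mx0_is_diag.
apply/is_diag_mxP => i j ne; rewrite mxE.
rewrite (is_diag_mxP (is_diag_tens (is_diag_ext (is_diag_par_part p dx))
  (scalar_mx_is_diag _ _))) //.
rewrite (is_diag_mxP (is_diag_tens _ IHd)) ?addr0 //.
by case: p {IHd}; rewrite ?expr1 ?diag_mx_is_diag // expr0 scalar_mx_is_diag.
Qed.

Lemma tens_block_tensrep d p x i j : gl_homog p x ->
  tens_block i j (tensrep d.+1 x : 'M[C]_((1 + k) * (tensdim d).+1)) =
  (ext x i j)%:A + (parmx ^+ p) i j *: tensrep d x.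
Proof.
move=> hx; rewrite !(tensrep_homog _ hx) [tensrep_par d.+1 p x]/= (par_part_id
  _ hx) eqxx.
by rewrite linearD /= !tens_block_tensmx.
Qed.

End TensorRepresentation.

(** * Adjoints and positivity *)

Section Adjoint.
Variable C : numClosedFieldType.

Definition adjmx n (A : 'M[C]_n) : 'M[C]_n := (map_mx Num.conj A)^T.

Lemma adjmxE n (A : 'M[C]_n) i j : adjmx A i j = (A j i)^*.
Proof. by rewrite !mxE. Qed.

Lemma adjmxM n (A B : 'M[C]_n) : adjmx (A * B) = adjmx B * adjmx A.
Proof. by rewrite /adjmx [map_mx _ _]map_mxM trmx_mul. Qed.

Lemma adjmxD n (A B : 'M[C]_n) : adjmx (A + B) = adjmx A + adjmx B.
Proof. by rewrite /adjmx map_mxD linearD. Qed.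

Lemma adjmxZ n c (A : 'M[C]_n) : adjmx (c *: A) = c^* *: adjmx A.
Proof. by rewrite /adjmx map_mxZ linearZ. Qed.

Lemma adjmx0 n : adjmx 0 = 0 :> 'M[C]_n.
Proof. by rewrite /adjmx map_mx0 trmx0. Qed.

Lemma adjmx1 n : adjmx 1%:M = 1%:M :> 'M[C]_n.
Proof. by rewrite /adjmx map_mx1 trmx1. Qed.

Lemma adjmx_tens m n (A : 'M[C]_m) (B : 'M[C]_n) :
  adjmx (A *t B) = adjmx A *t adjmx B.
Proof. by rewrite /adjmx map_mxT trmx_tens. Qed.

(** The trace is the sum of the squared absolute values of the entries. *)
Lemma mxtrace_adj_eq0 n (A : 'M[C]_n) : \tr (adjmx A * A) = 0 -> A = 0.
Proof.
have E j : (adjmx A * A) j j = \sum_i `|A i j| ^+ 2.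
  by rewrite mxE; apply: eq_bigr => i _; rewrite adjmxE normCK mulrC.
rewrite /mxtrace; under eq_bigr => j _ do rewrite E.
have ge0 j : 0 <= \sum_i `|A i j| ^+ 2 by apply: sumr_ge0 => i _;
  rewrite exprn_ge0.
move/eqP; rewrite psumr_eq0 // => /allP H0; apply/matrixP => i j; rewrite mxE.
have := H0 j (mem_index_enum _); rewrite /= psumr_eq0 => [/allP|? _];
  last by rewrite exprn_ge0.
by move=> /(_ i (mem_index_enum _)) /=; rewrite expf_eq0 /= normr_eq0 => /eqP.
Qed.

(** Both products have the same trace, so twice the trace of A^* A is zero. *)
Lemma adjmx_anticomm_eq0 n (A : 'M[C]_n) : A * adjmx A = - (adjmx A * A) ->
  A = 0.
Proof.
move=> antiA; apply: mxtrace_adj_eq0; apply/eqP.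
have := congr1 (@mxtrace C n) antiA; rewrite mxtrace_mulC raddfN /= => /eqP.
by rewrite -addr_eq0 -mulr2n mulrn_eq0.
Qed.

(** Let B = A^* A. Normality turns B^* B into A^* A^* A A = 0, so B = 0 and then A = 0, by
    positivity of the trace twice. *)
Lemma normalmx_nilp_eq0 n (A : 'M[C]_n) :
  A * adjmx A = adjmx A * A -> A * A = 0 -> A = 0.
Proof.
move=> nA AA0.
have: adjmx A * A = 0.
  apply: mxtrace_adj_eq0; rewrite adjmxM.
  have -> : adjmx (adjmx A) = A.
    by apply/matrixP => i j; rewrite !adjmxE conjCK.
  by rewrite -mulrA [A * (_ * _)]mulrA nA -mulrA AA0 !mulr0 raddf0.
by move=> E; apply: mxtrace_adj_eq0; rewrite E raddf0.
Qed.

Variable N : nat.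
Local Notation k := (N + N)%N.
Implicit Types (x y : 'M[C]_k) (p q : bool).

Lemma adjmx_homog p x : gl_homog p x -> gl_homog p (adjmx x).
Proof.
move=> /gl_homogP hx; apply/gl_homogP => i j;
  rewrite adjmxE conjC_eq0 => /hx <-.
exact: addbC.
Qed.

Lemma adjmx_queer x : x \in queer C N -> adjmx x \in queer C N.
Proof. by move=> /queerP sx; apply/queerP => a b; rewrite !adjmxE sx. Qed.

Lemma adjmx_ext x : adjmx (ext x) = ext (adjmx x).
Proof.
by rewrite /adjmx /ext map_block_mx tr_block_mx !map_mx0 !trmx0.
Qed.

Lemma adjmx_parmx (p : bool) : adjmx (@parmx C N ^+ p) = parmx C N ^+ p.
Proof.
case: p; rewrite ?expr1 ?expr0 ?adjmx1 //.
apply/matrixP => i j; rewrite adjmxE !parmxE rmorphMn rmorph_sign eq_sym.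
by case: eqP => // ->.
Qed.

Lemma adjmx_par_part p x : adjmx (par_part p x) = par_part p (adjmx x).
Proof.
by apply/matrixP => i j; rewrite !mxE rmorphMn addbC.
Qed.

(** J is self-adjoint, so conjugate transposition on q_N is compatible with every tensor power. *)
Lemma adjmx_tensrep d x : adjmx (tensrep d x) = tensrep d (adjmx x).
Proof.
have H p : adjmx (tensrep_par d p x) = tensrep_par d p (adjmx x).
  elim: d => [|d IHd] /=; first exact: adjmx0.
  rewrite -IHd -adjmx_par_part -adjmx_ext -[in RHS](adjmx_parmx p).
  rewrite -[in RHS](adjmx1 (tensdim N d).+1).
  rewrite -!(adjmx_tens _ _); exact: adjmxD.
by rewrite /tensrep adjmxD !H.
Qed.

End Adjoint.

(** * Generation of the enveloping algebra *)

Section Generation.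
Context (C : fieldType) (N : nat) (U : algType C).
Context (iota : {linear subvs_of (queer C N) -> U}).

Definition env_sum (u : U) : Prop :=
  exists u0 u1, [/\ u = u0 + u1, env_homog iota false u0 &
    env_homog iota true u1].

Definition env_gen : {pred U} := fun u => `[< env_sum u >].

Lemma env_homogD p u v :
  env_homog iota p u -> env_homog iota p v -> env_homog iota p (u + v).
Proof. by move=> hu hv; rewrite -[u]scale1r; apply: env_homog_lin. Qed.

Lemma env_gen_subalg_closed : subalg_closed env_gen.
Proof.
split.
- apply/asboolP; exists 1, 0; rewrite addr0; split=> //;
  first exact: env_homog_one.
  exact: env_homog_zero.
- move=> c _ _ /asboolP[u0 [u1 [-> hu0 hu1]]] /asboolP[v0 [v1 [-> hv0 hv1]]].
  apply/asboolP; exists (c *: u0 + v0), (c *: u1 + v1); split;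
    try exact: env_homog_lin.
  by rewrite scalerDr addrACA.
move=> _ _ /asboolP[u0 [u1 [-> hu0 hu1]]] /asboolP[v0 [v1 [-> hv0 hv1]]].
apply/asboolP; exists (u0 * v0 + u1 * v1), (u0 * v1 + u1 * v0); split.
- by rewrite mulrDl !mulrDr [u1 * v0 + _]addrC addrACA.
- apply: env_homogD; first exact: (env_homog_mul hu0 hv0).
  exact: (env_homog_mul hu1 hv1).
apply: env_homogD; first exact: (env_homog_mul hu0 hv1).
exact: (env_homog_mul hu1 hv0).
Qed.
HB.instance Definition _ :=
  GRing.isSubalgClosed.Build C U env_gen env_gen_subalg_closed.

Definition env_sub := {u : U | u \in env_gen}.
HB.instance Definition _ := SubChoice.on env_sub.
HB.instance Definition _ := [SubChoice_isSubAlgebra of env_sub by <:].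

Definition env_incl : env_sub -> U := val.
HB.instance Definition _ :=
  GRing.isLinear.Build C env_sub U _ env_incl (@linearP _ _ _ _ (val : {linear
    env_sub -> U})).
HB.instance Definition _ :=
  GRing.isMonoidMorphism.Build env_sub U env_incl (rmorphism_monoidP (val :
    {rmorphism env_sub -> U})).

Lemma queer_homog_parts (x : subvs_of (queer C N)) :
  exists y z, [/\ x = y + z, gl_homog false (vsval y) &
    gl_homog true (vsval z)].
Proof.
pose part p := vsproj (queer C N) (par_part p (vsval x)).
have partE p : vsval (part p) = par_part p (vsval x).
  by rewrite vsprojK // par_part_queer // subvsP.
exists (part false), (part true); split; rewrite ?partE ?par_part_homog //.
apply: val_inj; rewrite -[RHS]/(vsval (part false) + vsval (part true)).
by rewrite !partE -par_part_sum.
Qed.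

Lemma iota_gen x : iota x \in env_gen.
Proof.
have [y [z [-> hy hz]]] := queer_homog_parts x.
by apply/asboolP; exists (iota y), (iota z); rewrite linearD; split=> //;
  exact: env_homog_gen.
Qed.

Definition iota_sub (x : subvs_of (queer C N)) : env_sub := Sub (iota x)
  (iota_gen x).

Lemma iota_sub_is_linear : linear iota_sub.
Proof. by move=> c x y; apply: val_inj; rewrite [RHS]linearP;
  exact: linearP. Qed.
HB.instance Definition _ :=
  GRing.isLinear.Build C _ _ _ iota_sub iota_sub_is_linear.

Lemma val_scomm p q (a b : env_sub) :
  val (scomm p q a b) = scomm p q (val a) (val b).
Proof. by rewrite !scommE rmorphB rmorphM; case: ifP => _;
  rewrite ?rmorphN rmorphM. Qed.

(** The decomposable elements form a subalgebra containing the image of [iota]. The universal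
    property maps U to it; followed by the inclusion, this fixes [iota], hence is the identity by
    uniqueness. *)
Lemma env_generated (Uenv : enveloping iota) (u : U) : env_sum u.
Proof.
have [liota univ] := Uenv.
have lsub : lie_map iota_sub.
  move=> p q x y z hx hy ez; apply: val_inj; rewrite val_scomm.
  exact: liota.
have [phi [phiE _]] := univ _ _ lsub; have [psi [_ psiU]] := univ _ _ liota.
pose f : {lrmorphism U -> U} := env_incl \o phi.
have fE x : f (iota x) = iota x by rewrite /f /= phiE.
have idE x : (idfun : {lrmorphism U -> U}) (iota x) = iota x by [].
have := psiU _ fE u; rewrite -(psiU _ idE u) /= => <-.
by apply/asboolP; exact: (valP (phi u)).
Qed.

End Generation.

(** * Faithfulness of the tensor powers *)

Section Faithful.
Context (C : numFieldType) (N : nat) (U : algType C).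
Context (iota : {linear subvs_of (queer C N) -> U}).
Local Notation k := (N + N)%N.
Local Notation word := (seq (bool * subvs_of (queer C N))).
Implicit Types (w : word) (u v : U).

Definition word_homog w := all (fun px => gl_homog px.1 (vsval px.2)) w.
Definition word_val w : U := \prod_(px <- w) iota px.2.
Definition word_par w : bool := \big[addb/false]_(px <- w) px.1.

(* The inequality is strict: env_fil 0 is zero and env_fil 1 the scalars. *)
Inductive env_fil (n : nat) : U -> Prop :=
| env_fil0 : env_fil n 0
| env_fil_cons c w u :
    word_homog w -> (size w < n)%N -> env_fil n u ->
    env_fil n (c *: word_val w + u).

Lemma env_filD n u v : env_fil n u -> env_fil n v -> env_fil n (u + v).
Proof.
by move=> fu fv; elim: fu => [|c w u' hw sw _ IH]; rewrite ?add0r // -addrA;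
  apply: env_fil_cons.
Qed.

Lemma env_filZ n c u : env_fil n u -> env_fil n (c *: u).
Proof.
elim=> [|c' w u' hw sw _ IH]; first by rewrite scaler0; apply: env_fil0.
by rewrite scalerDr scalerA; apply: env_fil_cons.
Qed.

Lemma env_filN n u : env_fil n u -> env_fil n (- u).
Proof. by rewrite -scaleN1r; apply: env_filZ. Qed.

Lemma env_filB n u v : env_fil n u -> env_fil n v -> env_fil n (u - v).
Proof. by move=> fu fv; apply/env_filD/env_filN. Qed.

Lemma env_filMn n u m : env_fil n u -> env_fil n (u *+ m).
Proof. by rewrite -scaler_nat; apply: env_filZ. Qed.

Lemma env_fil_sum n (I : finType) (F : I -> U) :
  (forall i, env_fil n (F i)) -> env_fil n (\sum_i F i).
Proof.
by move=> fF; apply: (big_ind (env_fil n)) => //;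
  [apply: env_fil0|apply: env_filD].
Qed.

Lemma env_fil_word n w : word_homog w -> (size w < n)%N ->
  env_fil n (word_val w).
Proof.
move=> hw sw; rewrite -[word_val w]scale1r -[_ *: _]addr0.
by apply: env_fil_cons => //; apply: env_fil0.
Qed.

Lemma env_fil_leq m n u : (m <= n)%N -> env_fil m u -> env_fil n u.
Proof.
move=> le_mn; elim=> [|c w u' hw sw _ IH]; first exact: env_fil0.
by apply: env_fil_cons => //; apply: leq_trans le_mn.
Qed.

Lemma env_fil0_eq0 u : env_fil 0 u -> u = 0.
Proof. by case. Qed.

Lemma word_val_cons px w : word_val (px :: w) = iota px.2 * word_val w.
Proof. by rewrite /word_val big_cons. Qed.

Lemma word_val_rcons px w : word_val (rcons w px) = word_val w * iota px.2.
Proof. by rewrite /word_val big_rcons. Qed.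

Lemma env_filMl n x u : env_fil n u -> env_fil n.+1 (iota x * u).
Proof.
have [y [z [-> hy hz]]] := queer_homog_parts x; move=> fu.
have H p (t : subvs_of (queer C N)) : gl_homog p (vsval t) ->
  env_fil n.+1 (iota t * u).
  move=> ht; elim: fu => [|c w u' hw sw _ IH]; first by rewrite mulr0;
    apply: env_fil0.
  rewrite mulrDr -scalerAr -(word_val_cons (p, t)).
  by apply: env_fil_cons; rewrite //= ht.
by rewrite linearD mulrDl; apply: env_filD; [apply: H hy|apply: H hz].
Qed.

Lemma env_filMr n x u : env_fil n u -> env_fil n.+1 (u * iota x).
Proof.
have [y [z [-> hy hz]]] := queer_homog_parts x; move=> fu.
have H p (t : subvs_of (queer C N)) : gl_homog p (vsval t) ->
  env_fil n.+1 (u * iota t).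
  move=> ht; elim: fu => [|c w u' hw sw _ IH]; first by rewrite mul0r;
    apply: env_fil0.
  rewrite mulrDl -scalerAl -(word_val_rcons (p, t)).
  by apply: env_fil_cons; rewrite ?size_rcons // /word_homog all_rcons /= ht.
by rewrite linearD mulrDr; apply: env_filD; [apply: H hy|apply: H hz].
Qed.

Lemma env_filM m n u v : env_fil m u -> env_fil n v -> env_fil (m + n) (u * v).
Proof.
move=> fu fv; elim: fu => [|c w u' hw sw _ IH]; first by rewrite mul0r;
  apply: env_fil0.
rewrite mulrDl -scalerAl; apply/env_filD/IH/env_filZ.
apply: (@env_fil_leq (size w + n)); first by rewrite leq_add2r ltnW.
elim: w {hw sw} => [|px w IHw]; first by rewrite /word_val big_nil mul1r.
by rewrite word_val_cons -mulrA; apply: env_filMl.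
Qed.

Hypothesis Uenv : enveloping iota.

Lemma env_filE u : exists n, env_fil n u.
Proof.
have hom p v : env_homog iota p v -> exists n, env_fil n v.
  elim=> {p v} [p x hx||p q u' v _ [m fu] _ [n fv]|p a u' v _ [m fu] _ [n
    fv]|p].
  - exists 2%N; have -> : iota x = word_val [:: (p, x)].
      by rewrite word_val_cons /word_val big_nil mulr1.
    by apply: env_fil_word; rewrite //= hx.
  - exists 1%N; have -> : 1 = word_val [::] by rewrite /word_val big_nil.
    exact: env_fil_word.
  - by exists (m + n)%N; apply: env_filM.
  - exists (m + n)%N; apply: env_filD;
    first by apply/env_filZ/env_fil_leq/fu/leq_addr.
    by apply/env_fil_leq/fv/leq_addl.
  - by exists 0%N; apply: env_fil0.
have [u0 [u1 [-> /hom[m fu] /hom[n fv]]]] := env_generated Uenv u.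
exists (m + n)%N; apply: env_filD; first by apply/env_fil_leq/fu/leq_addr.
by apply/env_fil_leq/fv/leq_addl.
Qed.

(** The defining relation of U, with z the superbracket of x and y. *)
Lemma iota_swap p q (x y : subvs_of (queer C N)) :
  gl_homog p (vsval x) -> gl_homog q (vsval y) ->
  exists z, iota x * iota y = (-1) ^+ (p && q) *: (iota y * iota x) + iota z.
Proof.
move=> hx hy; have [liota _] := Uenv.
have Ez : vsval (vsproj (queer C N) (scomm p q (vsval x) (vsval y)))
    = scomm p q (vsval x) (vsval y).
  by rewrite vsprojK // queer_scomm // subvsP.
exists (vsproj _ (scomm p q (vsval x) (vsval y)));
  rewrite (liota p q x y _ hx hy Ez).
by rewrite scommE addrC; case: (p && q); rewrite ?scaleN1r ?scale1r subrK.
Qed.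

(** Each exchange of letters costs a word shorter by one letter: the associated graded algebra of U
    is supercommutative. *)
Lemma word_val_swap p x w : gl_homog p (vsval x) -> word_homog w ->
  env_fil (size w).+1 (word_val w * iota x
    - (-1) ^+ (p && word_par w) *: (iota x * word_val w)).
Proof.
move=> hx; elim: w => [|[q y] w IHw] /=.
  rewrite /word_val /word_par !big_nil andbF mul1r mulr1 expr0 scale1r subrr.
  by move=> _; apply: env_fil0.
case/andP=> hy hw; rewrite word_val_cons /= /word_par big_cons /= -/(word_par
  w).
have [z Ez] := iota_swap hy hx.
pose s : C := (-1) ^+ (p && word_par w); have := IHw hw; rewrite -/s.
move/(env_filMl y); rewrite mulrBr -scalerAr !mulrA Ez => Hw.
rewrite -[_ * iota x](subrK (s *: (((-1) ^+ (q && p) *: (iota x * iota y) +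
  iota z) * word_val w))).
rewrite -addrA; apply: env_filD => //.
have Es : s * (-1) ^+ (q && p) = (-1) ^+ (p && (q (+) word_par w)).
  by rewrite /s -signr_addb andb_addr [q && p]andbC addbC.
rewrite mulrDl -scalerAl !scalerDr scalerA Es.
rewrite addrAC subrr add0r.
by apply/env_filZ/env_filMl/env_fil_word.
Qed.

(* The image of word_val w under the coproduct U -> End(C^{1+2N}) (x) U. *)
Fixpoint coprod w : 'M[U]_(1 + k) :=
  if w is (p, x) :: w' then
    \matrix_(i, j) \sum_l (ext (vsval x) i l *: coprod w' l j
                           + (parmx C N ^+ p) i l *: (iota x * coprod w' l j))
  else 1%:M.

(** The leading part of the coproduct lets every letter act on the second factor, leaving only the
    Koszul signs J on the first. *)
Lemma coprod_lead w i j : word_homog w ->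
  env_fil (size w) (coprod w i j - (parmx C N ^+ word_par w) i j *: word_val w).
Proof.
elim: w i j => [|[p x] w IHw] i j /=.
  move=> _; rewrite /word_val /word_par !big_nil expr0 !mxE scaler_nat subrr.
  exact: env_fil0.
case/andP=> hx hw; rewrite word_val_cons /= /word_par big_cons /= -/(word_par
  w).
have -> : (parmx C N ^+ (p (+) word_par w)) i j
    = \sum_l (parmx C N ^+ p) i l * (parmx C N ^+ word_par w) l j.
  by rewrite -parmx_expD mxE.
rewrite scaler_suml mxE -sumrB; apply: env_fil_sum => l.
rewrite -addrA -scalerA -scalerBr scalerAr -mulrBr.
apply: env_filD; last exact/env_filZ/env_filMl/IHw.
apply: env_filZ; rewrite -[coprod w l j](subrK ((parmx C N ^+ word_par w) l j
  *: word_val w)).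
apply: env_filD; first exact/env_fil_leq/IHw.
exact/env_filZ/env_fil_word.
Qed.

Section Symbol.
Variable A : zmodType.

(* On ext x this is the coordinate of x along F_{pos i, b}, while it kills
   the identity and the parity operator. *)
Definition symb (i : 'I_N) (b : 'I_k) (M : 'I_(1 + k) -> 'I_(1 + k) -> A) : A :=
  M (rshift 1 (pos i)) (rshift 1 b) -
    M (lshift k ord0) (lshift k ord0) *+ (pos i == b).

End Symbol.

Lemma symb_parmx (p : bool) i b : symb i b (parmx C N ^+ p) = 0.
Proof.
rewrite /symb !parmx_exp_row ?ext_par0 ?ext_parS ?par_pos //.
by rewrite eq_rshift eqxx subrr.
Qed.

(** [symb] kills the power of J in front of the leading term, so one degree is lost. *)
Lemma symb_coprod_fil w i b : word_homog w ->
  env_fil (size w) (symb i b (coprod w)).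
Proof.
move=> hw; have := symb_parmx (word_par w) i b.
have := coprod_lead (rshift 1 (pos i)) (rshift 1 b) hw.
have := coprod_lead (lshift k ord0) (lshift k ord0) hw; rewrite /symb.
move: (coprod w) (parmx C N ^+ _) => M J f0 f1 /eqP; rewrite subr_eq0 => /eqP E.
have := env_filB f1 (env_filMn (pos i == b) f0).
by rewrite mulrnBl scalerMnl -E opprB addrA subrK.
Qed.

Lemma queer_iota_expand (x : subvs_of (queer C N)) :
  iota x = \sum_(i < N) \sum_b vsval x (pos i) b *: iota (Fq C (pos i) b).
Proof.
transitivity (iota (\sum_(i < N) \sum_b vsval x (pos i) b *: Fq C (pos i) b)).
  congr (iota _); apply: val_inj;
    rewrite [LHS](sym_expand (queer_sym (subvsP x))).
  rewrite [RHS]linear_sum; apply: eq_bigr => i _; rewrite [RHS]linear_sum.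
  apply: eq_bigr => b _; rewrite linearZ /= /Fq.
  by rewrite vsprojK ?Fmx_queer.
rewrite linear_sum; apply: eq_bigr => i _; rewrite linear_sum.
by apply: eq_bigr => b _; rewrite linearZ.
Qed.

Lemma ext_row0 (x : 'M[C]_k) (i : 'I_1) l : ext x (lshift k i) l = 0.
Proof.
by rewrite /ext; case: (split_ordP l) => j ->;
  rewrite ?block_mxEul ?block_mxEur mxE.
Qed.

Lemma parmx_exp_sum (p : bool) (a : 'I_(1 + k)) (F : 'I_(1 + k) -> U) :
  ext_par a = false -> \sum_l (parmx C N ^+ p) a l *: F l = F a.
Proof.
move=> pa; rewrite (bigD1 a) //= parmx_exp_row // eqxx scale1r big1 ?addr0 //
  => l.
by rewrite parmx_exp_row // eq_sym => /negbTE ->; rewrite scale0r.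
Qed.

Lemma parmx_exp_ext p (q : bool) (x : 'M[C]_k) : gl_homog p x ->
  ext x * parmx C N ^+ q = (-1) ^+ (p && q) *: (parmx C N ^+ q * ext x).
Proof.
move=> hx; case: q; rewrite ?andbT ?andbF ?expr0 ?expr1.
  by rewrite (parmx_ext hx) scalerA -expr2 sqrr_sign scale1r.
by rewrite mulr1 mul1r scale1r.
Qed.

(** Both rows that [symb] reads are even, so J^p is the identity there; row 0 of [ext] vanishes, so
    x acts on the first factor only through row [pos i]. *)
Lemma symb_coprod_cons p (x : subvs_of (queer C N)) w i b :
  symb i b (coprod ((p, x) :: w)) =
  \sum_l ext (vsval x) (rshift 1 (pos i)) l *: coprod w l (rshift 1 b)
  + iota x * symb i b (coprod w).
Proof.
rewrite /symb /= !mxE !big_split /= !parmx_exp_sum ?ext_par0 ?ext_parS ?par_pos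
  //.
rewrite [X in _ - (X + _) *+ _]big1 => [|l _]; last by rewrite ext_row0 scale0r.
by rewrite add0r mulrBr mulrnAr addrA.
Qed.

(** Insert the leading term of [coprod_lead]. The sign comes from moving [ext] of x past the power
    of J, which is then trivial on the even row [pos i]. *)
Lemma ext_coprod_lead p (x : subvs_of (queer C N)) w i b : gl_homog p (vsval x)
  -> word_homog w ->
  env_fil (size w)
    (\sum_l ext (vsval x) (rshift 1 (pos i)) l *: coprod w l (rshift 1 b)
     - ((-1) ^+ (p && word_par w) * vsval x (pos i) b) *: word_val w).
Proof.
move=> hx hw.
have -> : (-1) ^+ (p && word_par w) * vsval x (pos i) b =
    \sum_l ext (vsval x) (rshift 1 (pos i)) l *
      (parmx C N ^+ word_par w) l (rshift 1 b).
  have := congr1 (fun M : 'M_(1 + k) => M (rshift 1 (pos i)) (rshift 1 b))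
    (parmx_exp_ext (word_par w) hx).
  rewrite [_ (rshift _ _) _]mxE => ->; rewrite mxE; congr (_ * _).
  rewrite mxE (bigD1 (rshift 1 (pos i))) //= parmx_exp_row ?ext_parS ?par_pos
    //.
  rewrite eqxx mul1r ext_pos big1 ?addr0 // => l.
  rewrite parmx_exp_row ?ext_parS ?par_pos // eq_sym => /negbTE ->.
  by rewrite mul0r.
rewrite scaler_suml -sumrB; apply: env_fil_sum => l.
by rewrite -scalerA -scalerBr; apply/env_filZ/coprod_lead.
Qed.

(* Reassembling the first-order part of the coproduct gives back each letter
   of w in turn, moved to the right end. *)
Lemma symb_coprod_sum w : word_homog w ->
  env_fil (size w) (\sum_(i < N) \sum_b symb i b (coprod w) *
    iota (Fq C (pos i) b)
                    - word_val w *+ size w).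
Proof.
elim: w => [_|[p x] w IHw /= /andP[hx hw]].
  rewrite mulr0n subr0 big1 => [|i _]; first exact: env_fil0.
  rewrite big1 // => b _; rewrite /symb /= !mxE eq_rshift eqxx subrr mul0r.
  by [].
pose s : C := (-1) ^+ (p && word_par w).
(* The part of lower order in the term where x acts on the first factor. *)
pose E i b := \sum_l ext (vsval x) (rshift 1 (pos i)) l *: coprod w l (rshift 1
  b)
     - (s * vsval x (pos i) b) *: word_val w.
have splitE i b : symb i b (coprod ((p, x) :: w)) * iota (Fq C (pos i) b) =
    E i b * iota (Fq C (pos i) b)
    + (s *: (word_val w * (vsval x (pos i) b *: iota (Fq C (pos i) b)))
       + iota x * (symb i b (coprod w) * iota (Fq C (pos i) b))).
  rewrite symb_coprod_cons mulrDl mulrA addrA; congr (_ + _).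
  rewrite -scalerAr scalerA scalerAl -mulrDl; congr (_ * _).
  by rewrite /E subrK.
under eq_bigr => i _ do (under eq_bigr => b _ do rewrite splitE;
  rewrite !big_split /=
  -scaler_sumr -!mulr_sumr).
rewrite !big_split /= -scaler_sumr -!mulr_sumr -queer_iota_expand.
rewrite -addrA; apply: env_filD.
  do 2!(apply: env_fil_sum => ?).
  exact/env_filMr/ext_coprod_lead.
rewrite word_val_cons mulrS opprD addrACA; apply: env_filD; last first.
  by rewrite -mulrnAr -mulrBr; apply/env_filMl/IHw.
(* Writing 1 as s * s exposes the supercommutator bounded by [word_val_swap]. *)
rewrite -[iota x * _]scale1r -(sqrr_sign C (p && word_par w)) -/s expr2
  -scalerA -scalerBr.
exact/env_filZ/word_val_swap.
Qed.

(* A left inverse, modulo shorter words, of the representation on the d-th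
   tensor power. *)
Fixpoint unsymb d : 'M[C]_((tensdim N d).+1) -> U :=
  match d return 'M[C]_((tensdim N d).+1) -> U with
  | 0 => fun X => (X ord0 ord0)%:A
  | e.+1 => fun X : 'M[C]_((1 + k) * (tensdim N e).+1) =>
      (e.+1)%:R^-1 *: \sum_(i < N) \sum_b
        unsymb (symb i b (fun i j => tens_block i j X)) * iota (Fq C (pos i) b)
  end.

Lemma unsymb_is_linear d : linear (@unsymb d).
Proof.
elim: d => [|d IHd] c X Y /=.
  by rewrite !mxE scalerDl scalerA.
rewrite scalerA [c * _]mulrC -scalerA -scalerDr.
congr (_ *: _); rewrite scaler_sumr -big_split /=; apply: eq_bigr => i _.
rewrite scaler_sumr -big_split /=; apply: eq_bigr => b _.
rewrite scalerAl -mulrDl -IHd; congr (unsymb _ * _).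
by rewrite /symb !linearP /= mulrnDl scalerMnr opprD addrACA -scalerBr.
Qed.
HB.instance Definition _ d :=
  GRing.isLinear.Build C _ _ _ (@unsymb d) (@unsymb_is_linear d).

Lemma tens_block1 (m n : nat) (i j : 'I_m) :
  tens_block i j (1%:M : 'M[C]_(m * n)) = (i == j)%:R.
Proof.
apply/matrixP => a b; rewrite !mxE (inj_eq (can_inj (@mxtens_indexK m n)))
  xpair_eqE.
by case: (i == j); rewrite !mxE.
Qed.

(** The coproduct is compatible with the tensor powers: the power d + 1 is the first factor times
    the power d, block by block. *)
Lemma tens_block_coprod d (phi : {lrmorphism U -> 'M[C]_((tensdim N d).+1)})
    (psi : {lrmorphism U -> 'M[C]_((tensdim N d.+1).+1)}) w i j :
  (forall x, phi (iota x) = tensrep d (vsval x)) ->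
  (forall x, psi (iota x) = tensrep d.+1 (vsval x)) -> word_homog w ->
  tens_block i j (psi (word_val w) : 'M[C]_((1 + k) * (tensdim N d).+1)) =
  phi (coprod w i j).
Proof.
move=> phiE psiE; elim: w i j => [|[p x] w IHw] i j /=.
  move=> _; rewrite /word_val big_nil rmorph1 mxE rmorph_nat.
  exact: (@tens_block1 (1 + k) (tensdim N d).+1).
case/andP=> hx hw; rewrite word_val_cons rmorphM /= psiE.
transitivity (\sum_l tens_block i l (tensrep d.+1 (vsval x) : 'M[C]_((1 +
  k) * (tensdim N d).+1))
   * tens_block l j (psi (word_val w) : 'M[C]_((1 + k) * (tensdim N d).+1))).
  exact: (@tens_block_mul C (1 + k) (tensdim N d).+1).
rewrite mxE rmorph_sum; apply: eq_bigr => l _.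
rewrite IHw // (tens_block_tensrep _ _ _ hx) mulrDl rmorphD /= !linearZ /=
  rmorphM /= phiE.
by rewrite -!scalerAl mul1r.
Qed.

Definition tensrep_queer d (x : subvs_of (queer C N)) := tensrep d (vsval x).

Lemma tensrep_queer_is_linear d : linear (tensrep_queer d).
Proof. by move=> c x y; rewrite /tensrep_queer !linearP. Qed.
HB.instance Definition _ d :=
  GRing.isLinear.Build C _ _ _ (tensrep_queer d) (tensrep_queer_is_linear d).

Lemma tensrep_extends d : exists phi : {lrmorphism U ->
  'M[C]_((tensdim N d).+1)},
  forall x, phi (iota x) = tensrep d (vsval x).
Proof.
have [_ /(_ _ (tensrep_queer d))[|phi [phiE _]]] := Uenv; last by exists phi.
move=> p q x y z hx hy ez; rewrite -[LHS]/(tensrep d (vsval z)) ez.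
exact: tensrep_scomm.
Qed.

(** Induction on d. Applying [symb] to the blocks of [psi u] gives [phi] of an element of lower
    degree, which the induction hypothesis recovers modulo shorter words; [symb_coprod_sum] then
    returns the word once per letter, hence the division by d + 1. *)
Lemma unsymbK d (phi : {lrmorphism U -> 'M[C]_((tensdim N d).+1)}) u :
  (forall x, phi (iota x) = tensrep d (vsval x)) ->
  env_fil d.+1 u -> env_fil d (unsymb (phi u) - u).
Proof.
have unsymb_rep e (f : {lrmorphism U -> 'M[C]_((tensdim N e).+1)}) c a b :
    unsymb (f (c *: a + b)) = c *: unsymb (f a) + unsymb (f b).
  by rewrite linearP [LHS]linearP.
elim: d phi u => [|d IHd] psi u psiE.
  elim=> [|c w v hw sw _ IHv];
    first by rewrite rmorph0 [unsymb 0]linear0 subrr; apply: env_fil0.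
  rewrite unsymb_rep opprD addrACA -scalerBr; apply/env_filD/IHv/env_filZ.
  case: w sw {hw} => // _; rewrite /word_val big_nil rmorph1 /= mxE
    eqxx scale1r subrr.
  exact: env_fil0.
elim=> [|c w v hw sw _ IHv]; first by rewrite rmorph0 [unsymb 0]linear0 subrr;
  apply: env_fil0.
rewrite unsymb_rep opprD addrACA -scalerBr;
  apply/env_filD/IHv/env_filZ => {c v IHv}.
have [phi phiE] := tensrep_extends d.
pose F i b := iota (Fq C (pos i) b); pose S i b := symb i b (coprod w).
have -> : unsymb (psi (word_val w)) =
    (d.+1)%:R^-1 *: \sum_(i < N) \sum_b unsymb (phi (S i b)) * F i b.
  rewrite [LHS]/=; congr (_ *: _); apply: eq_bigr => i _; apply: eq_bigr => b _.
  congr (unsymb _ * _); rewrite /symb !(tens_block_coprod _ _ phiE psiE hw).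
  by rewrite -rmorphMn -rmorphB.
have -> : word_val w = (d.+1)%:R^-1 *: (word_val w *+ d.+1).
  by rewrite -scaler_nat scalerA mulVf ?pnatr_eq0 // scale1r.
rewrite -scalerBr; apply: env_filZ.
rewrite -[\sum_(i < N) _](subrK (\sum_(i < N) \sum_b S i b * F i b)) -addrA.
apply: env_filD.
  rewrite -sumrB; apply: env_fil_sum => i; rewrite -sumrB;
    apply: env_fil_sum => b.
  rewrite -mulrBl; apply/env_filMr/IHd => //.
  exact/env_fil_leq/symb_coprod_fil.
(* The multiplicity matters only for words of length exactly d + 1; shorter words already lie in
   [env_fil d.+1]. *)
have := symb_coprod_sum hw; rewrite ltnS leq_eqVlt in sw.
case/orP: sw => [/eqP-> //|sw /(env_fil_leq (ltnW sw)) fS].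
rewrite -[X in env_fil _ (X - _)](subrK (word_val w *+ size w)) -addrA.
by apply/env_filD/env_filB; try exact/env_filMn/env_fil_word.
Qed.

(** If all tensor powers kill u, [unsymbK] on the n-th one lowers the filtration bound from n + 1 to
    n; descend to 0. *)
Lemma tensrep_faithful u :
  (forall d (phi : {lrmorphism U -> 'M[C]_((tensdim N d).+1)}),
     (forall x, phi (iota x) = tensrep d (vsval x)) -> phi u = 0) ->
  u = 0.
Proof.
move=> ker_u; have [n] := env_filE u; elim: n => [|n IHn];
  first exact: env_fil0_eq0.
have [phi phiE] := tensrep_extends n; move=> fu; apply: IHn.
have := unsymbK phiE fu; rewrite (ker_u n phi phiE) linear0 sub0r => /env_filN.
by rewrite opprK.
Qed.

End Faithful.

(** * Injectivity of the Harish-Chandra map *)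

Section Positivity.
Context (C : numClosedFieldType) (N : nat) (U : algType C).
Context (iota : {linear subvs_of (queer C N) -> U}).
Hypothesis Uenv : enveloping iota.

(** Conjugate transposition of q_N is extended to products in reverse order; v follows the
    construction of u, so one v serves all tensor powers. *)
Lemma env_homog_adj p u : env_homog iota p u ->
  exists2 v, env_homog iota p v &
    forall d (phi : {lrmorphism U -> 'M[C]_((tensdim N d).+1)}),
      (forall x, phi (iota x) = tensrep d (vsval x)) -> phi v = adjmx (phi u).
Proof.
elim=> {p u} [p x hx||p q u v _ [u' hu' Eu] _ [v' hv' Ev]|p c u v _ [u' hu' Eu]
  _ [v' hv' Ev]|p].
- have Ey : vsval (vsproj (queer C N) (adjmx (vsval x))) = adjmx (vsval x).
    by rewrite vsprojK // adjmx_queer // subvsP.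
  exists (iota (vsproj _ (adjmx (vsval x)))).
    by apply: env_homog_gen; rewrite Ey adjmx_homog.
  by move=> d phi phiE; rewrite !phiE Ey adjmx_tensrep.
- exists 1; first exact: env_homog_one.
  by move=> d phi _; rewrite rmorph1 [RHS]adjmx1.
- exists (v' * u'); first by rewrite addbC; apply: env_homog_mul.
  by move=> d phi phiE; rewrite !rmorphM /= adjmxM (Eu _ _ phiE) (Ev _ _ phiE).
- exists (c^* *: u' + v'); first exact: env_homog_lin.
  by move=> d phi phiE; rewrite !linearP /= adjmxD adjmxZ (Eu _ _ phiE) (Ev _ _
    phiE).
exists 0; first exact: env_homog_zero.
by move=> d phi _; rewrite !rmorph0 adjmx0.
Qed.

(* An odd supercentral element anticommutes with its adjoint, so the trace of
   Z^* Z vanishes. *)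
Lemma odd_supercentral_eq0 z : env_homog iota true z ->
  (forall q u, env_homog iota q u -> scomm true q z u = 0) -> z = 0.
Proof.
move=> hz cz; apply: (tensrep_faithful Uenv) => d phi phiE.
have [v hv Ev] := env_homog_adj hz; apply: adjmx_anticomm_eq0.
rewrite -(Ev _ _ phiE) -!rmorphM -rmorphN; congr (phi _).
by have /eqP := cz _ _ hv; rewrite scommE /= opprK addr_eq0 => /eqP.
Qed.

Lemma supercentral_central z : supercentral iota z -> forall u, z * u = u * z.
Proof.
move=> [z0 [z1 [-> hz0 hz1 cz]]] u.
have -> : z1 = 0.
  by apply: odd_supercentral_eq0 => // q v hv; have [] := cz q v hv.
rewrite addr0; have [u0 [u1 [-> hu0 hu1]]] := env_generated Uenv u.
have comm q v : env_homog iota q v -> z0 * v = v * z0.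
  by move=> /cz[/eqP+ _]; rewrite scommE subr_eq0 => /eqP.
by rewrite mulrDl mulrDr (comm _ _ hu0) (comm _ _ hu1).
Qed.

(** The adjoint of [phi z] is again in the image of [phi], and z is central. *)
Lemma central_rep_normal z d (phi : {lrmorphism U ->
  'M[C]_((tensdim N d).+1)}) :
  (forall x, phi (iota x) = tensrep d (vsval x)) -> (forall u, z * u = u * z) ->
  phi z * adjmx (phi z) = adjmx (phi z) * phi z.
Proof.
move=> phiE cz; have [u0 [u1 [Ez hu0 hu1]]] := env_generated Uenv z.
have [v0 _ E0] := env_homog_adj hu0; have [v1 _ E1] := env_homog_adj hu1.
have -> : adjmx (phi z) = phi (v0 + v1).
  by rewrite Ez !rmorphD /= adjmxD (E0 _ _ phiE) (E1 _ _ phiE).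
by rewrite -!rmorphM cz.
Qed.

End Positivity.

(** * Weights, root vectors and the height operator *)

Section Weights.
Context (C : numFieldType) (N : nat).
Local Notation k := (N + N)%N.

(** The index of a weight: the basis vectors [pos i] and [neg i] have the same one. *)
Definition abs_idx (a : 'I_k) : 'I_N :=
  match split a with inl i => i | inr i => i end.

Lemma abs_pos i : abs_idx (pos i) = i.
Proof. by rewrite /abs_idx (unsplitK (inl i)). Qed.

Lemma abs_neg i : abs_idx (neg i) = i.
Proof. by rewrite /abs_idx (unsplitK (inr i)). Qed.

Lemma abs_opp a : abs_idx (opp_idx a) = abs_idx a.
Proof.
by case: (idx_cases a) => -[i ->]; rewrite ?opp_pos ?opp_neg ?abs_pos ?abs_neg.
Qed.

Lemma Fmx_cartan (l : 'I_N) :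
  Fmx C (pos l) (pos l) = diag_mx (\row_a (abs_idx a == l)%:R).
Proof.
apply/matrixP => a b; rewrite FmxE !mxE opp_pos.
have [<-|nab] := eqVneq a b; last first.
  have H c : (a == c) && (b == c) = false.
    by apply: contraNF nab => /andP[/eqP-> /eqP->].
  by rewrite !H addr0 mulr0n.
rewrite !andbb mulr1n; case: (idx_cases a) => -[i ->].
  by rewrite abs_pos eq_lshift eq_lrshift addr0.
by rewrite abs_neg eq_rshift eq_rlshift add0r.
Qed.

(** F_{i,b} has weight eps_i - eps_|b|, since its support lies in rows of absolute index i and
    columns of absolute index |b|. *)
Lemma Fmx_cartan_bracket (l i : 'I_N) b :
  Fmx C (pos l) (pos l) * Fmx C (pos i) b =
  Fmx C (pos i) b * Fmx C (pos l) (pos l)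
  + ((i == l)%:R - (abs_idx b == l)%:R) *: Fmx C (pos i) b.
Proof.
have supp a c : Fmx C (pos i) b a c != 0 ->
  abs_idx a = i /\ abs_idx c = abs_idx b.
  rewrite FmxE.
  case: (boolP (_ && _)) => [/andP[/eqP-> /eqP->] _|_];
    first by rewrite abs_pos.
  case: (boolP (_ && _)) => [/andP[/eqP-> /eqP->] _|_];
    last by rewrite addr0 eqxx.
  by rewrite !abs_opp abs_pos.
rewrite Fmx_cartan -[_ * _]/(_ *m _) -[_ *
  diag_mx _]/(_ *m _) mul_diag_mx mul_mx_diag.
apply/matrixP => a c; move: (Fmx C (pos i) b) supp => F supp; rewrite !mxE.
have [->|/supp[-> ->]] := eqVneq (F a c) 0; first by rewrite !mulr0 mul0r addr0.
by rewrite mulrBl [_ * (_ == _)%:R]mulrC addrC subrK.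
Qed.

End Weights.

Section RootSpaces.
Context (C : numFieldType) (N : nat) (U : algType C).
Context (iota : {linear subvs_of (queer C N) -> U}).
Local Notation k := (N + N)%N.

(** The relation r lets one induction principle serve both n_+ and n_-. *)
Lemma root_span_ind (r : rel 'I_N) (P : subvs_of (queer C N) -> Prop) :
  P 0 -> (forall c x y, P x -> P y -> P (c *: x + y)) ->
  (forall i b, r i (abs_idx b) -> P (Fq C (pos i) b)) ->
  forall y, y \in (\sum_(i < N) \sum_(j < N | r i j)
     (<[Fq C (pos i) (pos j)]> + <[Fq C (pos i) (neg j)]>))%VS -> P y.
Proof.
move=> P0 PL PF y /memv_sumP[f Hf ->].
have PD x z : P x -> P z -> P (x + z) by move=> ? ?; rewrite -[x]scale1r;
  apply: PL.
have PZ c x : P x -> P (c *: x) by move=> ?; rewrite -[_ *: _]addr0; apply: PL.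
apply: (big_ind P) => // i _; have /memv_sumP[g Hg ->] := Hf i isT.
apply: (big_ind P) => // j rij.
have /memv_addP[_ /vlineP[c ->] [_ /vlineP[c' ->] ->]] := Hg j rij.
by apply: PD; apply/PZ/PF; rewrite ?abs_pos ?abs_neg.
Qed.

Hypothesis liota : lie_map iota.

Lemma iota_cartan_bracket (l i : 'I_N) b :
  iota (Fq C (pos l) (pos l)) * iota (Fq C (pos i) b) =
  iota (Fq C (pos i) b) * iota (Fq C (pos l) (pos l))
  + ((i == l)%:R - (abs_idx b == l)%:R) *: iota (Fq C (pos i) b).
Proof.
set c := (_ - _).
have FqE a a' : vsval (Fq C a a') =
  Fmx C a a' by rewrite /Fq vsprojK ?Fmx_queer.
have hl : gl_homog false (vsval (Fq C (pos l) (pos l))).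
  by have := homog_Fmx C (pos l) (pos l); rewrite FqE addbb.
have hb : gl_homog (idx_par (pos i) (+) idx_par b) (vsval (Fq C (pos i) b)).
  by rewrite FqE homog_Fmx.
have Ez : vsval (c *: Fq C (pos i) b) =
    scomm false (idx_par (pos i) (+) idx_par b)
      (vsval (Fq C (pos l) (pos l))) (vsval (Fq C (pos i) b)).
  by rewrite scommE !FqE Fmx_cartan_bracket addrC addKr linearZ /= FqE.
have := liota hl hb Ez; rewrite scommE linearZ /= => ->.
by rewrite addrC subrK.
Qed.

(** The coefficients decrease strictly in l, so the bracket with F_{i,b} has eigenvalue |b| - i:
    positive on n_+, negative on n_-. *)
Definition cartan_height : subvs_of (queer C N) :=
  \sum_(l < N) (N - l)%:R *: Fq C (pos l) (pos l).

Lemma cartan_heightE :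
  vsval cartan_height = \sum_(l < N) (N - l)%:R *: Fmx C (pos l) (pos l).
Proof.
rewrite [LHS]linear_sum; apply: eq_bigr => l _; rewrite linearZ /= /Fq.
by rewrite vsprojK ?Fmx_queer.
Qed.

Lemma iota_height_bracket (i : 'I_N) b :
  iota cartan_height * iota (Fq C (pos i) b) =
  iota (Fq C (pos i) b) * iota cartan_height
  + ((N - i)%:R - (N - abs_idx b)%:R) *: iota (Fq C (pos i) b).
Proof.
rewrite /cartan_height linear_sum mulr_suml mulr_sumr.
have pick (j : 'I_N) : (N - j)%:R = \sum_(l < N) (N - l)%:R * (j == l)%:R :> C.
  rewrite (bigD1 j) //= eqxx mulr1 big1 ?addr0 // => l.
  by rewrite eq_sym => /negbTE ->; rewrite mulr0.
rewrite (pick i) (pick (abs_idx b)) -sumrB scaler_suml -big_split /=.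
apply: eq_bigr => l _; rewrite linearZ /= -scalerAl iota_cartan_bracket.
by rewrite -mulrBr -scalerA -scalerAr scalerDr.
Qed.

End RootSpaces.

(** * Central elements in n_- U + U n_+ vanish *)

Section KernelVanishing.
Context (C : numClosedFieldType) (N : nat) (U : algType C).
Context (iota : {linear subvs_of (queer C N) -> U}).
Local Notation k := (N + N)%N.
Hypothesis Uenv : enveloping iota.

(* Z = phi z preserves the eigenspaces of the height.  If Z kills all
   eigenspaces above h b, then Z * Z kills the one of h b, as z lies
   in n_- U + U n_+ and n_+ raises, n_- lowers the height; Z being normal, it
   kills that eigenspace too. *)
Lemma central_kernel_eq0 z :
  (forall u, z * u = u * z) -> triangular_kernel iota z -> z = 0.
Proof.
move=> cz [s [t [sn tn Ez]]]; apply: (tensrep_faithful Uenv) => d phi phiE.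
set Z := phi z; pose D := phi (iota (cartan_height C N)).
have cZ u : Z * phi u = phi u * Z by rewrite -!rmorphM cz.
have nZ : Z * adjmx Z = adjmx Z * Z by exact: (central_rep_normal Uenv phiE cz).
pose h a := D a a.
have diagD : D = diag_mx (\row_a h a).
  have /is_diag_mxP dD : is_diag_mx D.
    rewrite /D phiE; apply: tensrep_diag; rewrite cartan_heightE;
      apply/is_diag_mxP => i j ne.
    rewrite summxE big1 // => l _.
    by rewrite Fmx_cartan !mxE -[i == j]/(i == j :> nat) (negbTE ne) mulr0n
      mulr0.
  apply/matrixP => a b; rewrite !mxE; have [->|ne] := eqVneq a b;
    first by rewrite mulr1n.
  by rewrite dD // mulr0n.
have DlE (X : 'M[C]_((tensdim N d).+1)) a b : (D * X) a b = h a * X a b.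
  by rewrite diagD -[_ * _]/(_ *m _) mul_diag_mx !mxE.
have DrE (X : 'M[C]_((tensdim N d).+1)) a b : (X * D) a b = X a b * h b.
  by rewrite diagD -[_ * _]/(_ *m _) mul_mx_diag !mxE.
have Zh a b : Z a b != 0 -> h a = h b.
  move=> nz; have := congr1 (fun M : 'M_ _ =>
    M a b) (cZ (iota (cartan_height C N))).
  by rewrite /= DrE DlE [h a * _]mulrC => /(mulfI nz).
have gen (i : 'I_N) b (Y := phi (iota (Fq C (pos i) b))) a c :
    Y a c != 0 -> h a = h c + ((N - i)%:R - (N - abs_idx b)%:R).
  move=> nz; have := congr1 (fun M : 'M_ _ => M a c)
    (congr1 phi (iota_height_bracket (proj1 Uenv) i b)).
  rewrite /= rmorphD /= !rmorphM /= linearZ /= -/D -/Y DlE mxE DrE mxE.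
  by rewrite [h a * _]mulrC [_ * Y a c]mulrC -mulrDr => /(mulfI nz).
have upY y : y \in nplus C N -> forall a c, ~~ (h c < h a) ->
  phi (iota y) a c = 0.
  move: y; apply: (@root_span_ind C N (fun i j => (i < j)%N)
    (fun y => forall a c, ~~ (h c < h a) -> phi (iota y) a c = 0)) =>
      [a c _|e x x' Hx Hx' a c ne|i b lt_ib a c].
  - by rewrite !linear0 mxE.
  - by rewrite !linearP !mxE Hx // Hx' // mulr0 addr0.
  apply: contraNeq => /gen ->; rewrite ltrDl subr_gt0 ltr_nat.
  by rewrite ltn_sub2l // ltn_ord.
have dnY y : y \in nminus C N -> forall a c, ~~ (h a < h c) ->
  phi (iota y) a c = 0.
  move: y; apply: (@root_span_ind C N (fun i j => (j < i)%N)
    (fun y => forall a c, ~~ (h a < h c) -> phi (iota y) a c = 0)) =>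
      [a c _|e x x' Hx Hx' a c ne|i b lt_bi a c].
  - by rewrite !linear0 mxE.
  - by rewrite !linearP !mxE Hx // Hx' // mulr0 addr0.
  apply: contraNeq => /gen ->;
    rewrite -subr_gt0 opprD addNKr opprB subr_gt0 ltr_nat.
  by rewrite ltn_sub2l // ltn_ord.
(* Descending induction on the height, measured by the number of coordinates strictly above b. *)
suff colZ n b : (#|[set c | (h b < h c)%R]| < n)%N -> forall a, Z a b = 0.
  by apply/matrixP => a b; rewrite mxE (colZ _ b (leqnn _)).
elim: n b => // n IHn b; rewrite ltnS => card_b.
have {IHn card_b} IH c : h b < h c -> forall a, Z a c = 0.
  move=> lt_bc; apply: IHn; apply: leq_trans card_b; apply: proper_card.
  apply/properP; split.
    by apply/subsetP => c'; rewrite !inE; apply: lt_trans.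
  by exists c; rewrite !inE // ltxx.
(* The projector onto the eigenspace of height [h b]. *)
pose P : 'M[C]_((tensdim N d).+1) := diag_mx (\row_c (h c == h b)%:R).
have PlE (X : 'M[C]_((tensdim N d).+1)) a c : (P * X) a c =
  (h a == h b)%:R * X a c.
  by rewrite /P -[_ * X]/(_ *m _) mul_diag_mx !mxE.
have PrE (X : 'M[C]_((tensdim N d).+1)) a c : (X * P) a c =
  X a c * (h c == h b)%:R.
  by rewrite /P -[X * _]/(_ *m _) mul_mx_diag !mxE.
have ZP : Z * P = P * Z.
  apply/matrixP => a c; rewrite PlE PrE mulrC.
  by have [->|/Zh ->//] := eqVneq (Z a c) 0; rewrite !mulr0.
have adjP : adjmx P = P.
  apply/matrixP => a c; rewrite adjmxE !mxE rmorphMn rmorph_nat [c == a]eq_sym.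
  by case: (a =P c) => // ->.
have adjZP : adjmx Z * P = P * adjmx Z.
  by have := congr1 (@adjmx C _) ZP; rewrite !adjmxM adjP.
(* n_+ sends this eigenspace to greater heights, where Z vanishes. *)
have up0 y : y \in nplus C N -> Z * phi (iota y) * P = 0.
  move=> yn; apply/matrixP => a c; rewrite PrE mxE [RHS]mxE.
  have [Ec|] := eqVneq (h c) (h b); last by rewrite mulr0.
  rewrite mulr1 big1 // => e _; have [lt_ce|ge] := boolP (h c < h e).
    by rewrite IH ?mul0r // -Ec.
  by rewrite (upY y yn) ?mulr0.
(* Dually, n_- reaches height [h b] only from greater heights; there the rows of Z vanish too, as Z
   preserves the height. *)
have dn0 y : y \in nminus C N -> P * phi (iota y) * Z = 0.
  move=> yn; rewrite -mulrA; apply/matrixP => a c; rewrite PlE mxE [RHS]mxE.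
  have [Ea|] := eqVneq (h a) (h b); last by rewrite mul0r.
  rewrite mul1r big1 // => e _; have [lt_ae|ge] := boolP (h a < h e);
    last first.
    by rewrite (dnY y yn) ?mul0r.
  have [->|nz] := eqVneq (Z e c) 0; first by rewrite mulr0.
  by rewrite IH ?mulr0 // -(Zh _ _ nz) -Ea.
(* One Z is expanded in n_- U + U n_+; the other is moved by centrality next to the factor from n_-
   or n_+. *)
have ZZP : Z * P * (Z * P) = 0.
  rewrite {1}ZP; have -> : P * Z * (Z * P) = P * phi z * (Z * P) by [].
  rewrite Ez rmorphD !rmorph_sum mulrDr mulrDl !mulr_sumr !mulr_suml.
  rewrite big_seq big1 ?add0r => [|[y u] /(allP sn) /= yn]; last first.
    by rewrite rmorphM /= !mulrA -(mulrA (P *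
      phi (iota y))) -cZ !mulrA dn0 // !mul0r.
  rewrite big_seq big1 // => -[u y] /(allP tn) /= yn.
  by rewrite rmorphM /= -!mulrA [phi (iota y) * (_ * _)]mulrA -cZ up0 // !mulr0.
(* P is self-adjoint and commutes with Z and its adjoint, so Z * P is normal, and its square is
   zero. *)
have ZP0 : Z * P = 0.
  apply: normalmx_nilp_eq0 => //; rewrite adjmxM adjP -!mulrA.
  apply/esym; rewrite [adjmx Z * (_ * _)]mulrA -nZ -mulrA adjZP.
  by rewrite [LHS]mulrA -ZP -mulrA.
move=> a; have := PrE Z a b; rewrite ZP0 eqxx mulr1 => <-.
by rewrite mxE.
Qed.

End KernelVanishing.

(** * Multiplicativity of the Harish-Chandra map *)

(** The target ring need not be commutative; commuting values of h suffice to regroup the powers. *)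
Lemma mmap1_mul_commuting (n : nat) (S : nzRingType) (h : 'I_n -> S) :
  (forall i j, GRing.comm (h i) (h j)) ->
  {morph mmap1 h : m1 m2 / (m1 + m2)%MM >-> m1 * m2}.
Proof.
move=> commh m1 m2; rewrite /mmap1.
elim: (index_enum _) => [|i r IHr]; first by rewrite !big_nil mulr1.
rewrite !big_cons IHr mnmDE exprD -!mulrA; congr (_ * _); rewrite !mulrA.
congr (_ * _); apply: commr_prod => j _.
by apply/commrX/commr_sym/commrX/commr_sym.
Qed.

Section HarishChandra.
Context (C : numClosedFieldType) (N : nat) (U : algType C).
Context (iota : {linear subvs_of (queer C N) -> U}).
Hypothesis Uenv : enveloping iota.
Local Notation ker := (triangular_kernel iota).
Local Notation ev := (eval_cartan iota).
Implicit Types (u v w z : U) (p q : {mpoly C[N]}).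

Lemma eval_cartanP c p q : ev (c *: p + q) = c *: ev p + ev q.
Proof. by rewrite /eval_cartan mmapD mmapZ /= mulr_algl. Qed.

Lemma cartan_comm (i j : 'I_N) :
  GRing.comm (iota (Fq C (pos i) (pos i))) (iota (Fq C (pos j) (pos j))).
Proof.
rewrite /GRing.comm (iota_cartan_bracket (proj1 Uenv)) abs_pos subrr scale0r.
by rewrite addr0.
Qed.

Lemma eval_cartanM p q : ev (p * q) = ev p * ev q.
Proof.
have evX m : ev 'X_[m] = mmap1 (fun i => iota (Fq C (pos i) (pos i))) m.
  by rewrite /eval_cartan mmapX.
have ev0 : ev 0 = 0 by rewrite /eval_cartan mmap0.
elim/mpolyind: p => [|c m p _ _ IHp]; first by rewrite ev0 !mul0r.
rewrite mulrDl -scalerAl !eval_cartanP IHp mulrDl -scalerAl; congr (_ *: _ + _).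
elim/mpolyind: q {IHp} => [|e m' q _ _ IHq]; first by rewrite ev0 !mulr0.
rewrite mulrDr -scalerAr !eval_cartanP IHq mulrDr -scalerAr -mpolyXD !evX.
by rewrite mmap1_mul_commuting //; exact: cartan_comm.
Qed.

Lemma triangular_kernel0 : ker 0.
Proof. by exists [::], [::]; split=> //; rewrite !big_nil addr0. Qed.

Lemma triangular_kernelD u v : ker u -> ker v -> ker (u + v).
Proof.
move=> [s [t [sn tn ->]]] [s' [t' [sn' tn' ->]]].
exists (s ++ s'), (t ++ t'); split; rewrite ?all_cat ?sn ?tn //.
by rewrite !big_cat /= addrACA.
Qed.

(** Centrality lets v pass the factors from n_+, which must stay rightmost. *)
Lemma triangular_kernelMr u v : ker u -> (forall w, v * w = w * v) ->
  ker (u * v).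
Proof.
move=> [s [t [sn tn ->]]] cv.
exists [seq (yu.1, yu.2 * v) | yu <- s], [seq (ux.1 * v, ux.2) | ux <- t];
  split.
- by rewrite all_map.
- by rewrite all_map.
rewrite !big_map mulrDl !mulr_suml; congr (_ + _); apply: eq_bigr => x _ /=.
  by rewrite mulrA.
by rewrite -!mulrA cv.
Qed.

Lemma triangular_kernelZ c u : ker u -> ker (c *: u).
Proof.
move=> ku; rewrite -[u]mulr1 scalerAr; apply: triangular_kernelMr => // w.
by rewrite mulr_algl mulr_algr.
Qed.

Lemma triangular_kernel_nminus y u : y \in nminus C N -> ker (iota y * u).
Proof.
move=> yn; exists [:: (y, u)], [::]; split; rewrite //= ?yn //.
by rewrite big_seq1 big_nil addr0.
Qed.

(** The bracket with F_ii preserves n_-, so F_ii can be moved past it; U n_+ is a left ideal. *)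
Lemma triangular_kernel_cartan i u : ker u ->
  ker (iota (Fq C (pos i) (pos i)) * u).
Proof.
have adn y : y \in nminus C N -> exists2 y', y' \in nminus C N &
    iota (Fq C (pos i) (pos i)) * iota y =
      iota y * iota (Fq C (pos i) (pos i)) + iota y'.
  move: y; apply: (@root_span_ind C N (fun i j => (j < i)%N) (fun y =>
    exists2 y', y' \in nminus C N &
    iota (Fq C (pos i) (pos i)) * iota y =
      iota y * iota (Fq C (pos i) (pos i)) + iota y')).
  - by exists 0; rewrite ?mem0v // !linear0 mulr0 mul0r addr0.
  - move=> c x y [x' xn Ex] [y' yn Ey]; exists (c *: x' + y');
    first by rewrite memvD ?memvZ.
    by rewrite !linearP /= mulrDr mulrDl -scalerAr -scalerAl Ex Ey scalerDr
      addrACA.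
  move=> j b lt_bj; exists ((((j == i)%:R -
    (abs_idx b == i)%:R : C)) *: Fq C (pos j) b).
    apply: memvZ; rewrite /nminus memvE; apply: (sumv_sup j) => //.
    apply: (sumv_sup (abs_idx b)) => //.
    by case: (idx_cases b) => -[l ->]; rewrite ?abs_pos ?abs_neg;
      [apply: addvSl|apply: addvSr].
  by rewrite linearZ (iota_cartan_bracket (proj1 Uenv)).
move=> [s [t [sn tn ->]]]; rewrite mulrDr !mulr_sumr; apply: triangular_kernelD.
  rewrite big_seq; apply: (big_ind ker) => [||[y v] /(allP sn)/= yn].
  - exact: triangular_kernel0.
  - exact: triangular_kernelD.
  have [y' yn' E] := adn _ yn; rewrite mulrA E mulrDl -mulrA.
  by apply: triangular_kernelD; apply: triangular_kernel_nminus.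
exists [::], [seq (iota (Fq C (pos i) (pos i)) * ux.1, ux.2) | ux <- t];
  split=> //.
  by rewrite all_map.
by rewrite big_nil add0r big_map; apply: eq_bigr => x _; rewrite mulrA.
Qed.

Lemma triangular_kernel_evall p u : ker u -> ker (ev p * u).
Proof.
move=> ku; elim/mpolyind: p => [|c m p _ _ IHp].
  by rewrite /eval_cartan mmap0 mul0r; apply: triangular_kernel0.
rewrite eval_cartanP mulrDl -scalerAl;
  apply/triangular_kernelD/IHp/triangular_kernelZ.
rewrite /eval_cartan mmapX /mmap1.
elim: (index_enum _) => [|i r IHr]; first by rewrite big_nil mul1r.
rewrite big_cons -mulrA; elim: (m i) => [|e IHe]; first by rewrite expr0 mul1r.
by rewrite exprS -mulrA; apply: triangular_kernel_cartan.
Qed.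

(** Kept as a relation: its closure under sums, scalars and products transports a determinant from U
    to polynomials. *)
Definition central_HC z p := (forall u, z * u = u * z) /\ is_HC iota z p.

Lemma central_HC0 : central_HC 0 0.
Proof.
split=> [u|]; first by rewrite mul0r mulr0.
by rewrite /is_HC /eval_cartan mmap0 subr0; apply: triangular_kernel0.
Qed.

Lemma central_HC1 : central_HC 1 1.
Proof.
split=> [u|]; first by rewrite mul1r mulr1.
rewrite /is_HC /eval_cartan -mpolyC1 mmapC /= scale1r subrr.
exact: triangular_kernel0.
Qed.

Lemma central_HC_lin c z p w q :
  central_HC z p -> central_HC w q -> central_HC (c *: z + w) (c *: p + q).
Proof.
move=> [cz kz] [cw kw]; split=> [u|].
  by rewrite mulrDl mulrDr -scalerAl -scalerAr cz cw.
rewrite /is_HC eval_cartanP opprD addrACA -scalerBr.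
exact/triangular_kernelD/kw/triangular_kernelZ.
Qed.

Lemma central_HCD z p w q :
  central_HC z p -> central_HC w q -> central_HC (z + w) (p + q).
Proof. by move=> hz hw; rewrite -[z]scale1r -[p]scale1r;
  apply: central_HC_lin. Qed.

Lemma central_HCZ c z p : central_HC z p -> central_HC (c *: z) (c *: p).
Proof.
move=> hz; rewrite -[c *: z]addr0 -[c *: p]addr0.
exact/central_HC_lin/central_HC0.
Qed.

(** Split z w - ev p ev q as (z - ev p) w + ev p (w - ev q): w is central, and the kernel is stable
    under left multiplication by Cartan elements. *)
Lemma central_HCM z p w q :
  central_HC z p -> central_HC w q -> central_HC (z * w) (p * q).
Proof.
move=> [cz kz] [cw kw]; split=> [u|]; first by rewrite -mulrA cw mulrA cz mulrA.
rewrite /is_HC; have -> : z * w - ev (p * q) =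
  (z - ev p) * w + ev p * (w - ev q).
  by rewrite eval_cartanM mulrBl mulrBr addrA subrK.
apply: triangular_kernelD; first exact: triangular_kernelMr.
exact: triangular_kernel_evall.
Qed.

Lemma central_HC_eq0 z : central_HC z 0 -> z = 0.
Proof.
move=> [cz]; rewrite /is_HC /eval_cartan mmap0 subr0.
exact: central_kernel_eq0.
Qed.

Lemma central_HC_iter_seqT (D : nat -> U) (P : nat -> {mpoly C[N]}) k m :
  (forall j, (0 < j)%N -> central_HC (D j) (P j)) -> (0 < m)%N ->
  central_HC (iter k (@seqT _) D m) (iter k (@seqT _) P m).
Proof.
move=> HDP; elim: k m => [|k IHk] m m_gt0 /=; first exact: HDP.
rewrite /seqT; apply: central_HCD; first exact: IHk.
by rewrite -!scaler_nat; apply/central_HCZ/IHk.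
Qed.

Lemma central_HC_det n (A : 'M[U]_n) (B : 'M[{mpoly C[N]}]_n) :
  (forall i j, central_HC (A i j) (B i j)) -> central_HC (\det A) (\det B).
Proof.
move=> HAB; rewrite /determinant; apply: (big_ind2 central_HC).
- exact: central_HC0.
- by move=> ? ? ? ?; apply: central_HCD.
move=> s _; apply: central_HCM.
  case: (perm.odd_perm s); rewrite ?expr0 ?expr1; last exact: central_HC1.
  by rewrite -[-1]scaleN1r -[X in central_HC _ X]scaleN1r;
    apply/central_HCZ/central_HC1.
apply: (big_ind2 central_HC) => //; first exact: central_HC1.
by move=> ? ? ? ?; apply: central_HCM.
Qed.

End HarishChandra.

(* The determinant of a matrix over U is given by the Leibniz formula; here
   the entries lie in the center, hence commute. *)
Theorem theorem5p4 (R : realType) (N : nat) (N_gt0 : (0 < N)%N)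
    (U : algType R[i]) (iota : {linear subvs_of (queer R[i] N) -> U})
    (Uenv : enveloping iota)
    (D : nat -> U)
    (Dcap : forall j : nat, (0 < j)%N -> is_capelli iota j (D j)) :
  (forall r : nat, (0 < r)%N ->
     \det (\matrix_(i < N.+1, k < N.+1) iter k (@seqT U) D (r + i)%N) = 0)
  /\
  (forall m k : nat, (0 < m)%N ->
     iter k (@seqT U) D m =
     \sum_(l < k.+1)
        ((l`!)%:R^-1 *
         \sum_(t < l.+1)
            (-1) ^+ (l - t) * ('C(l, t))%:R * ((m + t) ^ k)%N%:R : R[i])
        *: D (m + l)%N).
Proof.
split=> [r r_gt0 | m k _]; last exact: iter_seqT_sum.
(* The polynomials are chosen for all j at once, with dummy value 0 at j = 0. *)
have [P HP] : exists P : nat -> {mpoly R[i][N]}, forall j, (0 < j)%N ->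
    is_Qminus j (P j) /\ is_HC iota (D j) (P j).
  have /choice[P HP] j : exists p : {mpoly R[i][N]}, (0 < j)%N ->
      is_Qminus j p /\ is_HC iota (D j) p.
    have [j_gt0|] := boolP (0 < j)%N; last by exists 0.
    by have [_ [p Qp HCp]] := Dcap j j_gt0; exists p.
  by exists P.
(* By injectivity it suffices that the Harish-Chandra image is 0, and 0 is rewritten as the
   determinant of the images. *)
apply: (central_HC_eq0 Uenv).
rewrite -(@det_iter_seqT_Qminus _ _ P r) // => [|j /HP[]//].
apply: (central_HC_det Uenv) => i k; rewrite !mxE.
apply: central_HC_iter_seqT; rewrite ?addn_gt0 ?r_gt0 // => j j_gt0.
have [_ HCj] := HP j j_gt0;
  have [/(supercentral_central Uenv) cD _] := Dcap j j_gt0.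
by split.
Qed.
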